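(* Let $\mathfrak g$ be a contragredient Lie algebra of finite growth with symmetrizable Cartan matrix, and $\mathcal A$ a $\mathfrak g$-admissible algebra such that the automorphisms $T_i$ of $U(\mathfrak g)$ admit extensions to automorphisms $T_i:\mathcal A\to\mathcal A$ satisfying the braid group relations of $\mathfrak g$. Let $\check q_i=q_{\alpha_i,\mathfrak n}\circ T_i:\mathcal A'/\mathcal A'\mathfrak n\to\mathcal A'/\mathcal A'\mathfrak n$ for $\alpha_i\in\Pi$. Then for any $x\in\mathcal A'/\mathcal A'\mathfrak n$, $y\in Z^{\mathfrak n}(\mathcal A)$, $h\in\mathfrak h$ and $d\in D$ we have $$\check q_i([h,x])=[s_{\alpha_i}(h),\check q_i(x)],\qquad \check q_i(xd)=\check q_i(x)\cdot(s_{\alpha_i}\circ d),\qquad \check q_i(xy)=\check q_i(x)\cdot\check q_i(y).$$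
   Context: The ground field is $\mathbb C$. $\mathfrak g$ is a contragredient (Kac–Moody) Lie algebra of finite growth with symmetrizable Cartan matrix $(a_{i,j})$, Gauss decomposition $\mathfrak g=\mathfrak n_-+\mathfrak h+\mathfrak n$, simple roots $\Pi=\{\alpha_i\}$, root system $\Delta=\Delta_+\sqcup\Delta_-$, real roots $\Delta^{re}$, Weyl group $W$. Chevalley generators $e_{\pm\alpha_i}$, $h_{\alpha_i}\in\mathfrak h$ satisfy $[e_{\alpha_i},e_{-\alpha_j}]=\delta_{i,j}h_{\alpha_i}$, $[h_{\alpha_i},e_{\pm\alpha_j}]=\pm a_{i,j}e_{\pm\alpha_j}$ and the Serre relations; $d_i\in\mathbb N$ are such that $(\alpha_i,\alpha_j)=d_ia_{i,j}=d_ja_{j,i}$. For a root $\gamma=\sum n_i\alpha_i$ put $t_\gamma=\sum n_id_ih_{\alpha_i}$; $h_\gamma=2t_\gamma/(\gamma,\gamma)$ (the coroot) if $\gamma$ is real, $h_\gamma=t_\gamma$ if $\gamma$ is imaginary. $D$ is the localization of $U(\mathfrak h)$ at the multiplicative set generated by $\{h_\gamma+k:\gamma\in\Delta,k\in\mathbb Z\}$. For an integral weight $\mu$, $\tau_\mu$ is the automorphism of $D$ with $\tau_\mu(h)=h+\langle h,\mu\rangle$, $h\in\mathfrak h$. The shifted action of a simple reflection is the automorphism $d\mapsto s_{\alpha_i}\circ d$ of $D$ with $s_{\alpha_i}\circ h=s_{\alpha_i}(h)-\langle h,\alpha_i\rangle$ for $h\in\mathfrak h$ (induced by $w\circ\mu=w(\mu+\rho)-\rho$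 on $\mathfrak h^*$). An associative algebra $\mathcal A$ containing $U(\mathfrak g)$ as a subalgebra carries the adjoint action of $U(\mathfrak g)$, denoted $\hat g(a)=\mathrm{ad}_g(a)$, with $\hat g(a)=ga-ag$ for $g\in\mathfrak g$. $\mathcal A$ is called $\mathfrak g$-admissible if: (a) there is a subspace $\mathcal V\subset\mathcal A$, invariant under the adjoint action, such that multiplication induces isomorphisms of vector spaces $U(\mathfrak g)\otimes\mathcal V\to\mathcal A$ and $\mathcal V\otimes U(\mathfrak g)\to\mathcal A$; (b) the adjoint action on $\mathcal V$ of every real root vector is locally nilpotent, and the adjoint action of $\mathfrak h$ on $\mathcal V$ is semisimple. Put $\mathcal A'=D\otimes_{U(\mathfrak h)}\mathcal A$ (the localized algebra); $\mathcal A'\mathfrak n$ is the left ideal generated by $\mathfrak n$; $\mathcal A'/\mathcal A'\mathfrak n$ is a $D$-bimodule, so $[h,x]=hx-xh$ makes sense in it. $Z^{\mathfrak n}(\mathcal A)=\mathrm{Nr}(\mathcal A'\mathfrak n)/\mathcal A'\mathfrak n$ with $\mathrm{Nr}(\mathcal A'\mathfrak n)=\{x\in\mathcal A':\mathfrak nx\subset\mathcal A'\mathfrak n\}$; this algebra acts on $\mathcal A'/\mathcal A'\mathfrak n$ by right multiplication. The operators $\check q_i$ map $Z^{\mathfrak n}(\mathcal A)$ into itself, which gives meaning to the last product. $T_i$ ($\alpha_i\in\Pi$) are automorphisms of $U(\mathfrak g)$ lifting the simple reflections $s_{\alpha_i}:\mathfrak h\to\mathfrak h$ and satisfying the braid relations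 $\underbrace{T_iT_jT_i\cdots}_{m_{i,j}}=\underbrace{T_jT_iT_j\cdots}_{m_{i,j}}$ (e.g. those of Lusztig), where $m_{i,j}=2,3,4,6$ if $a_{i,j}a_{j,i}=0,1,2,3$ respectively and $m_{i,j}=\infty$ (no relation) if $a_{i,j}a_{j,i}>3$. The assumed extensions to $\mathcal A$ satisfy the same relations and are extended canonically to $\mathcal A'$. Put $\mathfrak n^{s_{\alpha_i}}=T_i(\mathfrak n)$, so $T_i$ induces a map $\mathcal A'/\mathcal A'\mathfrak n\to\mathcal A'/\mathcal A'\mathfrak n^{s_{\alpha_i}}$. For $\alpha=\alpha_i$, the map $q_{\alpha,\mathfrak n}:\mathcal A'\to\mathcal A'/\mathcal A'\mathfrak n$ is $$q_{\alpha,\mathfrak n}(x)=\sum_{n\ge0}\frac{(-1)^n}{n!}\,\hat e_\alpha^{\,n}(x)\,e_{-\alpha}^n\,\big(h_\alpha(h_\alpha-1)\cdots(h_\alpha-n+1)\big)^{-1}\mod\mathcal A'\mathfrak n,\qquad x\in\mathcal A,$$ extended to $\mathcal A'$ by $q_{\alpha,\mathfrak n}(xd)=q_{\alpha,\mathfrak n}(x)\tau_\alpha(d)$, $d\in D$. It vanishes on $\mathcal A'\mathfrak n^{s_\alpha}$ and so induces $q_{\alpha,\mathfrak n}:\mathcal A'/\mathcal A'\mathfrak n^{s_\alpha}\to\mathcal A'/\mathcal A'\mathfrak n$. *)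

(* Defs.v *)
From HB Require Import structures.
From mathcomp Require Import all_boot all_order all_algebra generic_quotient.
From mathcomp Require Import boolp classical_sets reals.
From mathcomp Require Export complex.
Set Implicit Arguments.
Unset Strict Implicit.
Unset Printing Implicit Defensive.
Import GRing.Theory.
Local Open Scope ring_scope.

Section LinearPreliminaries.
Variable K : fieldType.

Definition bilinear_map (M N P : lmodType K) (b : M -> N -> P) : Prop :=
  (forall c x x' y, b (c *: x + x') y = c *: b x y + b x' y) /\
  (forall c x y y', b x (c *: y + y') = c *: b x y + b x y').

(* The multiplication map [m] exhibits [P] as the tensor product of [M] and
   [N] over [K]; equivalently, the induced map from the tensor product to
   [P] is an isomorphism. *)
Definition is_tensor (M N P : lmodType K) (m : M -> N -> P) : Prop :=
  bilinear_map m /\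
  forall (L : lmodType K) (b : M -> N -> L), bilinear_map b ->
    exists2 f : {linear P -> L}, (forall x y, f (m x y) = b x y) &
      forall f' : {linear P -> L}, (forall x y, f' (m x y) = b x y) -> f' =1 f.

(* The same over a [K]-algebra [S], where [M] is a right and [N] a left
   [S]-module through the actions [ra] and [la]. *)
Definition is_balanced_tensor (S : algType K) (M N P : lmodType K)
    (ra : M -> S -> M) (la : S -> N -> N) (m : M -> N -> P) : Prop :=
  let balanced (L : lmodType K) (b : M -> N -> L) :=
    bilinear_map b /\ (forall x s y, b (ra x s) y = b x (la s y)) in
  balanced P m /\
  forall (L : lmodType K) (b : M -> N -> L), balanced L b ->
    exists2 f : {linear P -> L}, (forall x y, f (m x y) = b x y) &
      forall f' : {linear P -> L}, (forall x y, f' (m x y) = b x y) -> f' =1 f.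

Definition submod_set (V : lmodType K) (P : V -> Prop) : Prop :=
  P 0 /\ forall c x y, P x -> P y -> P (c *: x + y).

(* The subset of [S] multiplicatively generated by [G], and the localization
   of a commutative algebra at a multiplicative subset. *)
Definition mult_closure (S : comAlgType K) (G : S -> Prop) (x : S) : Prop :=
  exists2 s : seq S, (forall y, y \in s -> G y) & x = \prod_(y <- s) y.

Definition is_localization (S : comAlgType K) (G : S -> Prop)
    (D : comUnitAlgType K) (l : {lrmorphism S -> D}) : Prop :=
  [/\ forall s, G s -> l s \is a GRing.unit,
      forall d, exists u s, G s /\ d = l u / l s
    & forall u, l u = 0 -> exists2 s, G s & s * u = 0].

End LinearPreliminaries.

Record lieAlgebra (K : fieldType) := LieAlgebra {
  lie_car :> lmodType K;
  bracket : lie_car -> lie_car -> lie_car;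
  bracket_bilinear : bilinear_map bracket;
  bracketxx : forall x, bracket x x = 0;
  jacobi : forall x y z, bracket x (bracket y z) + bracket y (bracket z x)
                         + bracket z (bracket x y) = 0 }.

Section LieSubsets.
Variables (K : fieldType) (g : lieAlgebra K).

Definition lie_subalgebra (P : g -> Prop) : Prop :=
  submod_set P /\ forall x y, P x -> P y -> P (bracket x y).

Definition lie_ideal (P : g -> Prop) : Prop :=
  submod_set P /\ forall x y, P y -> P (bracket x y).

Definition lie_gen (G : g -> Prop) (x : g) : Prop :=
  forall P, lie_subalgebra P -> (forall y, G y -> P y) -> P x.

End LieSubsets.

(* [i : L -> U] is the universal enveloping algebra of the Lie algebra
   [(L, br)]. *)
Definition is_enveloping (K : fieldType) (L : lmodType K) (br : L -> L -> L)
    (U : algType K) (i : {linear L -> U}) : Prop :=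
  let lie_hom (B : algType K) (f : {linear L -> B}) :=
    forall x y, f (br x y) = f x * f y - f y * f x in
  lie_hom U i /\
  forall (B : algType K) (f : {linear L -> B}), lie_hom B f ->
    exists2 F : {lrmorphism U -> B}, (forall x, F (i x) = f x) &
      forall F' : {lrmorphism U -> B}, (forall x, F' (i x) = f x) -> F' =1 F.

Section CartanMatrix.
Variables (r : nat) (a : 'M[int]_r).

Definition generalized_cartan : Prop :=
  [/\ forall i, a i i = 2,
      forall i j, i != j -> (a i j <= 0)%R
    & forall i j, a i j = 0 -> a j i = 0].

Definition symmetrizes (d : 'I_r -> nat) : Prop :=
  (forall i, (0 < d i)%N) /\
  (forall i j, (d i)%:Z * a i j = (d j)%:Z * a j i).

(* The row vector [(n_i)_i] stands for [\sum_i n_i alpha_i]. *)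
Definition simple_root (i : 'I_r) : 'rV[int]_r := delta_mx 0 i.

Definition lattice_refl (i : 'I_r) (n : 'rV[int]_r) : 'rV[int]_r :=
  n - (\sum_j a i j * n 0 j) *: simple_root i.

Definition real_root (n : 'rV[int]_r) : Prop :=
  exists (w : seq 'I_r) (j : 'I_r),
    n = foldr lattice_refl (simple_root j) w.

Definition root_form (d : 'I_r -> nat) (n m : 'rV[int]_r) : int :=
  \sum_i \sum_j n 0 i * m 0 j * ((d i)%:Z * a i j).

Definition height (n : 'rV[int]_r) : int := \sum_i n 0 i.

(* The order [m_ij] as a function of [a_ij a_ji]; [None] is infinity. *)
Definition braid_order (p : int) : option nat :=
  if p == 0 then Some 2 else if p == 1 then Some 3
  else if p == 2 then Some 4 else if p == 3 then Some 6 else None.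

Fixpoint alternate (B : Type) (m : nat) (f f' : B -> B) (x : B) : B :=
  if m is m'.+1 then f (alternate m' f' f x) else x.

Definition braid_relations (B : Type) (T : 'I_r -> B -> B) : Prop :=
  forall i j m, i != j -> braid_order (a i j * a j i) = Some m ->
    alternate m (T i) (T j) =1 alternate m (T j) (T i).

End CartanMatrix.

(* The contragredient Lie algebra of [a] with its Cartan subalgebra (embedded
   by [cartan_in]) and Chevalley generators: a quotient by the largest ideal
   meeting the Cartan subalgebra trivially, over a minimal realization. *)
Record kacMoody (K : fieldType) (r : nat) (a : 'M[int]_r) := KacMoody {
  km_lie :> lieAlgebra K;
  cartan : vectType K;
  cartan_in : {linear cartan -> km_lie};
  coroot : 'I_r -> cartan;
  sroot : 'I_r -> 'Hom(cartan, K^o);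
  gen_e : 'I_r -> km_lie;
  gen_f : 'I_r -> km_lie;
  cartan_in_inj : injective cartan_in;
  coroot_free : free [tuple coroot i | i < r];
  sroot_free : free [tuple sroot i | i < r];
  sroot_coroot : forall i j, sroot j (coroot i) = (a i j)%:~R;
  cartan_dim :
    (\dim {:cartan} + \rank (map_mx intr a : 'M[K]_r) = r + r)%N;
  bracket_hh : forall h h', bracket (cartan_in h) (cartan_in h') = 0;
  bracket_ef : forall i j, bracket (gen_e i) (gen_f j) =
                           if i == j then cartan_in (coroot i) else 0;
  bracket_he : forall h j, bracket (cartan_in h) (gen_e j) =
                           (sroot j h : K) *: gen_e j;
  bracket_hf : forall h j, bracket (cartan_in h) (gen_f j) =
                           - ((sroot j h : K) *: gen_f j);
  serre_e : forall i j, i != j ->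
    iter `|1 - a i j|%N (bracket (gen_e i)) (gen_e j) = 0;
  serre_f : forall i j, i != j ->
    iter `|1 - a i j|%N (bracket (gen_f i)) (gen_f j) = 0;
  km_generated : forall x : km_lie,
    lie_gen (fun y => (exists h, y = cartan_in h) \/
                      (exists i, y = gen_e i \/ y = gen_f i)) x;
  km_reduced : forall P : km_lie -> Prop, lie_ideal P ->
    (forall h, P (cartan_in h) -> h = 0) -> forall x, P x -> x = 0 }.

Section RootData.
Variables (K : fieldType) (r : nat) (a : 'M[int]_r) (g : kacMoody K a).
Implicit Types (n : 'rV[int]_r) (h : cartan g).

Definition root_val n h : K := \sum_j (n 0 j)%:~R * (sroot g j h : K).

Definition weight_space n (x : g) : Prop :=
  forall h, bracket (cartan_in g h) x = root_val n h *: x.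

Definition is_root n : Prop := n != 0 /\ exists2 x, x != 0 & weight_space n x.

(* Polynomial growth of the principal gradation: the part of degree at most
   [N] in absolute value has a spanning family of polynomial size. *)
Definition finite_growth : Prop :=
  exists C k : nat, forall N : nat, exists s : seq g,
    (size s <= C * N.+1 ^ k)%N /\
    forall n x, (`|height n| <= N)%N -> weight_space n x ->
      exists c : nat -> K, x = \sum_(i < size s) c i *: s`_i.

Definition cartan_refl (i : 'I_r) h : cartan g :=
  h - (sroot g i h : K) *: coroot g i.

Definition t_root (d : 'I_r -> nat) n : cartan g :=
  \sum_i (n 0 i * (d i)%:Z)%:~R *: coroot g i.

Definition h_root (d : 'I_r -> nat) n : cartan g :=
  if `[< real_root a n >] then (2 / (root_form a d n n)%:~R) *: t_root d n
  else t_root d n.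

Definition nil_pos (x : g) : Prop := lie_gen (fun y => exists i, y = gen_e g i) x.

Definition localization_set (d : 'I_r -> nat) (Uh : comAlgType K)
    (iUh : cartan g -> Uh) : Uh -> Prop :=
  mult_closure (fun u => exists n (k : int),
    is_root n /\ u = iUh (h_root d n) + k%:~R).

End RootData.

Section Adjoint.
Variables (K : fieldType) (r : nat) (a : 'M[int]_r) (g : kacMoody K a).
Variables (A : algType K).

Definition ad (z x : A) : A := z * x - x * z.

Variables (U : algType K) (iU : g -> U) (jA : {lrmorphism U -> A}).

(* [jA] makes [U] a subalgebra of [A], and the subspace of the definition is
   the image of [v]. *)
Definition admissible : Prop :=
  injective jA /\
  exists (V : lmodType K) (v : {linear V -> A}), injective v /\
  [/\ (forall (x : g) w, exists w', ad (jA (iU x)) (v w) = v w'),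
      is_tensor (fun u w => jA u * v w) /\ is_tensor (fun w u => v w * jA u),
      (forall n (x : g) w, real_root a n -> weight_space n x ->
         exists N, iter N (ad (jA (iU x))) (v w) = 0)
    & (forall w, exists2 s : seq V, w = \sum_(w' <- s) w' &
         forall w', w' \in s -> exists mu : cartan g -> K,
           forall h, ad (jA (iU (cartan_in g h))) (v w') = mu h *: v w')].

End Adjoint.

Section LeftIdeal.
Variables (K : fieldType) (B : algType K) (N : B -> Prop).

Definition left_ideal : {pred B} := [pred x | `[< exists2 s : seq (B * B),
  (forall p, p \in s -> N p.2) & x = \sum_(p <- s) p.1 * p.2 >]].

Lemma left_ideal_zmod : zmod_closed left_ideal.
Proof.
split=> [|x y /asboolP[s Ns ->] /asboolP[t Nt ->]]; apply/asboolP.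
  by exists [::]; rewrite ?big_nil.
exists (s ++ [seq (- p.1, p.2) | p <- t]) => [p|].
  by rewrite mem_cat => /orP[/Ns//|/mapP[q /Nt Nq ->]].
rewrite big_cat big_map /= -sumrN; congr (_ + _).
by apply: eq_bigr => p _; rewrite mulNr.
Qed.

HB.instance Definition _ := GRing.isZmodClosed.Build B left_ideal left_ideal_zmod.

Definition lquot : zmodType := Quotient.quot left_ideal.

Definition lpi (x : B) : lquot := (\pi_(Quotient.quot left_ideal) x)%qT.
Definition lrepr (x : lquot) : B := repr (x : Quotient.quot left_ideal).

Definition lact (b : B) (x : lquot) : lquot := lpi (b * lrepr x).

(* The right multiplications on the quotient by the left ideal are computed
   on representatives; they do not depend on them when the right factor
   normalizes the left ideal. *)
Definition ract (x : lquot) (b : B) : lquot := lpi (lrepr x * b).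
Definition lquot_mul (x y : lquot) : lquot := ract x (lrepr y).

Definition lquot_comm (b : B) (x : lquot) : lquot := lact b x - ract x b.

Definition normalizer_quot (x : lquot) : Prop :=
  exists2 y, (forall z, N z -> z * y \in left_ideal) & x = lpi y.

End LeftIdeal.

Section Zhelobenko.
Variables (K : fieldType) (r : nat) (a : 'M[int]_r) (g : kacMoody K a).
Variables (D : comUnitAlgType K) (A A' : algType K).
Variables (kap : cartan g -> D) (gA : g -> A) (lA : A -> A') (dA : D -> A').
Variables (tau : 'I_r -> D -> D) (T' : 'I_r -> A' -> A').

Definition nilA (z : A') : Prop := exists2 x : g, nil_pos x & z = lA (gA x).

Definition nilA_refl (i : 'I_r) (z : A') : Prop :=
  exists2 x : g, nil_pos x & z = T' i (lA (gA x)).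

Definition zhel_term (i : 'I_r) (x : A) (n : nat) : A' :=
  ((-1) ^+ n / n`!%:R) *:
    (lA (iter n (ad (gA (gen_e g i))) x) * lA (gA (gen_f g i)) ^+ n *
     dA (\prod_(k < n) (kap (coroot g i) - k%:R))^-1).

(* As [ad e] is locally nilpotent on an admissible algebra, the series over
   [n >= 0] is the finite sum up to any [N] with [(ad e)^N x = 0]. *)
Definition is_zhel (i : 'I_r) (q : A' -> lquot nilA) : Prop :=
  [/\ forall x y, q (x + y) = q x + q y,
      forall x N, iter N (ad (gA (gen_e g i))) x = 0 ->
        q (lA x) = lpi nilA (\sum_(n < N) zhel_term i x n)
    & forall x d, q (x * dA d) = ract (q x) (dA (tau i d))].

(* The unique map satisfying [is_zhel]. *)
Definition zhel (i : 'I_r) : A' -> lquot nilA :=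
  xget (fun=> 0) [set q | is_zhel i q].

(* [zhel] vanishes on the left ideal generated by [nilA_refl i], so the choice
   of representatives below is immaterial. *)
Definition zhel_ind (i : 'I_r) (x : lquot (nilA_refl i)) : lquot nilA :=
  zhel i (lrepr x).

Definition T_ind (i : 'I_r) (x : lquot nilA) : lquot (nilA_refl i) :=
  lpi (nilA_refl i) (T' i (lrepr x)).

Definition qcheck (i : 'I_r) (x : lquot nilA) : lquot nilA :=
  zhel_ind (T_ind i x).

End Zhelobenko.

Arguments zhel_ind {K r a g D A A'} kap gA lA dA tau T' i x.
Arguments T_ind {K r a g A A'} gA lA T' i x.
Arguments qcheck {K r a g D A A'} kap gA lA dA tau T' i x.
Arguments zhel {K r a g D A A'} kap gA lA dA tau i _.
Arguments is_zhel {K r a g D A A'} kap gA lA dA tau i q.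

(* Main.v *)
From HB Require Import structures.
Require Import Defs.
From mathcomp Require Import all_boot all_order all_algebra generic_quotient.
From mathcomp Require Import boolp classical_sets.
From mathcomp Require Import reals complex.
From mathcomp Require Import ring zify.
Set Implicit Arguments.
Unset Strict Implicit.
Unset Printing Implicit Defensive.
Import Order.TTheory GRing.Theory Num.Theory.
Local Open Scope ring_scope.

(** Fix a simple root [alpha] with Chevalley generators [e], [f] and coroot
[h]. The quotient [M] of [A'] by the left ideal [A'n] is a left [A']-module
and a right [D]-module; write [v_0] for the class of 1. In the universal
Verma module generated by [v_0], the vectors
  [v_n = f^n (h (h - 1) ... (h - n + 1))^-1 v_0]
satisfy [e v_n = n v_(n-1)] and [f v_n = (h + n + 2) v_(n+1)]. With
[x_m = (-1)^m / m! (ad e)^m x] the Zhelobenko operator is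
[q(x) = \sum_m x_m v_m]. The maps [x |-> x_m] are the coefficients of
[exp (- t ad e)], which is multiplicative, so the shifted series
[F_k(x) = \sum_m x_m v_(m+k)] obey
  [F_k(x y) = \sum_j x_j F_(k+j)(y)], [e F_(k+1) = (k + 1) F_k], [e F_0 = 0],
  [F_k(f y) = f F_k(y) - (h + k + 2) F_(k+1)(y)].
The last identity determines [F_(k+1)] from [F_k]. Read as a recursion, it
extends the [F_k] to additive maps [Q_k] on the whole of [A'] with [Q_0 = q],
and the other identities persist ([zhigherM], [raising_zhigher1]).

Three consequences carry the theorem.
- For [x = h'] in the Cartan subalgebra the series stops after two terms:
  [q(h' y) = (h' + alpha(h')) q(y)]. Combined with [q(y d) = q(y) tau(d)] this
  gives [q([h', y]) = [h', q(y)]], and composing with [T_i] gives the first two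
  identities, as [tau] after the reflection is the shifted action.
- [q], hence every [Q_k], vanishes on the left ideal generated by [f] and by
  the strings [(ad e)^k e_j], [j <> i] ([q_reflected]).
- If [f y] lies in that ideal, the recursion becomes
  [Q_(k+1)(y) = (h + k + 2)^-1 f Q_k(y)], the one that [v_k] satisfies. So
  [Q_k(y)] is to [q(y)] what [v_k] is to [v_0], and the product formula turns
  into [q(x y) = q(x) q(y)] ([q_normalizes_mul]).

The ideal above is [A' T_i(n)] ([nilA_refl_gen]). Only the restriction of
[T_i] to the Cartan subalgebra is known, so this is an argument on weights:
choose [h'] with value 1 on all simple roots. [T_i] carries the weight of
[h'] to that of [s_i h'], and an element of positive weight under [h'] (under
[s_i h']) lies in the left ideal generated by the [e_j] (by [f] and the
strings), because by a triangular decomposition only weights [<= 0] survive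
modulo that ideal.

The localization enters through one fact: a weight vector [x] whose weight
is integral on coroots satisfies [D x = x D]. The weights of [A] are
integral by sl2-theory, and all the [h_gamma] lie in the lattice spanned by
the simple coroots, so shifting by such a weight preserves the denominators.
Consequently [A'] is spanned by the products [x d] ([localized_ind]). *)

(** * Induction for enveloping algebras and tensor products *)

Section Subspace.
Variables (K : fieldType) (V : lmodType K) (S : V -> Prop) (SP : submod_set S).

Definition subspace_pred : {pred V} := fun x => `[< S x >].

Lemma subspace_pred_closed : submod_closed subspace_pred.
Proof.
case: SP => S0 SD; split; first exact/asboolP.
by move=> c x y /asboolP Sx /asboolP Sy; apply/asboolP/SD.
Qed.

HB.instance Definition _ := GRing.isSubmodClosed.Build K V subspace_pred subspace_pred_closed.

Definition subspace := {x : V | subspace_pred x}.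
HB.instance Definition _ := SubType.on subspace.
HB.instance Definition _ := Choice.on subspace.
HB.instance Definition _ := [SubChoice_isSubLmodule of subspace by <:].

Lemma subspace_inclusion : exists (L : lmodType K) (inc : {linear L -> V}),
  [/\ injective inc, forall l, S (inc l) & forall x, S x -> exists l, inc l = x].
Proof.
exists subspace, (val : {linear subspace -> V}); split; first exact: val_inj.
  by case=> x Sx; apply/asboolP.
by move=> x /asboolP Sx; exists (exist _ x Sx : subspace).
Qed.
End Subspace.
Section Subalg.
Variables (K : fieldType) (B : algType K) (S : B -> Prop).
Hypotheses (SP : submod_set S) (S1 : S 1) (SM : forall x y, S x -> S y -> S (x * y)).

Definition subalgebra_pred : {pred B} := fun x => `[< S x >].

Lemma subalgebra_pred_closed : subalg_closed subalgebra_pred.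
Proof.
case: SP => S0 SD; split; first exact/asboolP.
  by move=> c x y /asboolP Sx /asboolP Sy; apply/asboolP/SD.
by move=> x y /asboolP Sx /asboolP Sy; apply/asboolP/SM.
Qed.

HB.instance Definition _ := GRing.isSubalgClosed.Build K B subalgebra_pred subalgebra_pred_closed.

Definition subalgebra := {x : B | subalgebra_pred x}.
HB.instance Definition _ := SubType.on subalgebra.
HB.instance Definition _ := Choice.on subalgebra.
HB.instance Definition _ := [SubChoice_isSubAlgebra of subalgebra by <:].

Lemma subalgebra_inclusion : exists (L : algType K) (inc : {lrmorphism L -> B}),
  [/\ injective inc, forall l, S (inc l) & forall x, S x -> exists l, inc l = x].
Proof.
pose inc : {rmorphism subalgebra -> B} := (val : {rmorphism subalgebra -> B}).
have incZ : scalable inc by move=> c x.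
pose i1 := GRing.isScalable.Build K subalgebra B *:%R inc incZ.
pose i2 : {lrmorphism subalgebra -> B} := HB.pack (inc : subalgebra -> B) inc i1.
exists subalgebra, i2; split; first exact: val_inj.
  by case=> x Sx; apply/asboolP.
by move=> x /asboolP Sx; exists (exist _ x Sx : subalgebra).
Qed.
End Subalg.

Lemma lift_linear (K : fieldType) (L V W : lmodType K) (inc : {linear L -> W})
    (f : V -> W) : injective inc -> (forall x, exists l, inc l = f x) ->
  (forall c x y, f (c *: x + y) = c *: f x + f y) ->
  exists f' : {linear V -> L}, forall x, inc (f' x) = f x.
Proof.
move=> inc_inj inc_onto fD; pose f1 x := projT1 (cid (inc_onto x)).
have f1E x : inc (f1 x) = f x by rewrite /f1; case: cid.
have f1D c x y : f1 (c *: x + y) = c *: f1 x + f1 y.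
  by apply: inc_inj; rewrite linearP !f1E fD.
pose m := GRing.isLinear.Build K V L *:%R f1 f1D.
by exists (HB.pack f1 m : {linear V -> L}).
Qed.

(** An enveloping algebra is generated by its Lie algebra: if [S] is a
subalgebra containing the Lie algebra, the universal property lifts the
inclusion to a map into [S], and its uniqueness clause makes the composite
with the inclusion of [S] the identity. *)
Lemma enveloping_ind (K : fieldType) (L : lmodType K) (br : L -> L -> L)
    (U : algType K) (i : {linear L -> U}) (S : U -> Prop) :
  is_enveloping br i -> submod_set S -> S 1 ->
  (forall x y, S x -> S y -> S (x * y)) -> (forall x, S (i x)) ->
  forall u, S u.
Proof.
move=> [iH Uuniv] SP S1 SM Si u.
have [B [inc [inc_inj incS Sinc]]] := subalgebra_inclusion SP S1 SM.
have [f fE] := lift_linear inc_inj (fun x => Sinc _ (Si x)) (@linearP _ _ _ _ i).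
have [x y|F FE _] := Uuniv B f.
  by apply: inc_inj; rewrite rmorphB !rmorphM /= !fE iH.
have [G GE Guniq] := Uuniv U i iH.
have incF : (inc \o F : {lrmorphism U -> U}) =1 G.
  by apply: Guniq => x /=; rewrite FE fE.
have idF : (idfun : {lrmorphism U -> U}) =1 G by apply: Guniq.
by rewrite -[u]/(idfun u) idF -incF; apply: incS.
Qed.

(** As for [enveloping_ind]: the span of the pure tensors is a submodule,
and the universal property provides a section of its inclusion. *)
Lemma balanced_tensor_ind (K : fieldType) (S : algType K) (M N P : lmodType K)
    (ra : M -> S -> M) (la : S -> N -> N) (m : M -> N -> P) (Q : P -> Prop) :
  is_balanced_tensor ra la m -> submod_set Q -> (forall x y, Q (m x y)) ->
  forall p, Q p.
Proof.
move=> [[[mDl mDr] mB] Puniv] QP Qm p.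
have [L [inc [inc_inj incQ Qinc]]] := subspace_inclusion QP.
pose b x y := projT1 (cid (Qinc _ (Qm x y))).
have bE x y : inc (b x y) = m x y by rewrite /b; case: cid.
have [|f fE _] := Puniv L b.
  split; first split=> [c x x' y|c x y y'];
    try by apply: inc_inj; rewrite linearP !bE ?mDl ?mDr.
  by move=> x s y; apply: inc_inj; rewrite !bE.
have [//|h _ huniq] := Puniv P m.
have fh : (inc \o f : {linear P -> P}) =1 h by apply: huniq => x y /=; rewrite fE bE.
have idh : (idfun : {linear P -> P}) =1 h by apply: huniq.
by rewrite -[p]/(idfun p) idh -fh; apply: incQ.
Qed.

Lemma tensor_ind (K : fieldType) (M N P : lmodType K) (m : M -> N -> P)
    (Q : P -> Prop) :
  is_tensor m -> submod_set Q -> (forall x y, Q (m x y)) -> forall p, Q p.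
Proof.
move=> [mB Puniv]; have [mDl mDr] := mB.
have mZl c x y : m (c *: x) y = c *: m x y.
  have m0 : m 0 y = 0 by have := mDl (-1) 0 0 y; rewrite scaler0 addr0 scaleN1r addNr.
  by rewrite -[c *: x]addr0 mDl m0 addr0.
have mZr c x y : m x (c *: y) = c *: m x y.
  have m0 : m x 0 = 0 by have := mDr (-1) x 0 0; rewrite scaler0 addr0 scaleN1r addNr.
  by rewrite -[c *: y]addr0 mDr m0 addr0.
(* A tensor product over the base field is balanced over that field. *)
apply: (@balanced_tensor_ind K K^o M N P (fun x s => s *: x) *:%R m).
split=> [|L b [bb _]]; last exact: Puniv.
by split=> // x s y; rewrite mZl mZr.
Qed.

(** * The quotient by a left ideal as a left module *)

Section LeftIdealQuotient.
Variables (K : fieldType) (B : algType K) (N : B -> Prop).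
Local Notation J := (left_ideal N).
Local Notation M := (Quotient.quot J).
Implicit Types (b : B).

Lemma left_idealM b x : x \in J -> b * x \in J.
Proof.
move=> /asboolP[s Ns ->]; apply/asboolP.
exists [seq (b * p.1, p.2) | p <- s] => [p /mapP[q /Ns Nq ->]//|].
by rewrite big_map mulr_sumr; apply: eq_bigr => p _; rewrite mulrA.
Qed.

Lemma left_idealZ (k : K) x : x \in J -> k *: x \in J.
Proof. by move=> Jx; rewrite -mulr_algl left_idealM. Qed.

Lemma mem_left_ideal z : N z -> z \in J.
Proof.
move=> Nz; apply/asboolP; exists [:: (1, z)] => [p|]; first by rewrite inE => /eqP->.
by rewrite big_seq1 mul1r.
Qed.

Lemma left_ideal_ind (P : B -> Prop) : P 0 -> (forall x y, P x -> P y -> P (x + y)) ->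
  (forall b z, N z -> P (b * z)) -> forall x, x \in J -> P x.
Proof.
move=> P0 PD PM x /asboolP[s Ns ->].
elim: s Ns => [|p s IH] Ns; rewrite ?big_nil// big_cons; apply: PD.
  by apply: PM; apply: Ns; rewrite mem_head.
by apply: IH => q sq; apply: Ns; rewrite in_cons sq orbT.
Qed.

Lemma lpiP b c : reflect (lpi N b = lpi N c) (b - c \in J).
Proof. by rewrite Quotient.idealrBE; apply: eqP. Qed.

Lemma lpi_eq0 b : (lpi N b == 0) = (b \in J).
Proof.
by rewrite -[in RHS](subr0 b) (sameP (lpiP b 0) eqP) /lpi raddf0.
Qed.

Lemma lreprK (x : lquot N) : lpi N (lrepr x) = x.
Proof. exact: reprK. Qed.

Lemma lact_lpi b c : lact b (lpi N c) = lpi N (b * c).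
Proof.
apply/lpiP; rewrite -mulrBr left_idealM//.
by apply/lpiP; rewrite lreprK.
Qed.

Lemma lactA b c (x : M) : lact b (lact c x : lquot N) = lact (b * c) (x : lquot N).
Proof. by rewrite -[x]lreprK !lact_lpi mulrA. Qed.

Lemma lact1 : left_id 1 (@lact K B N).
Proof. by move=> x; rewrite -[x]lreprK lact_lpi mul1r. Qed.

Lemma lactDr : right_distributive (@lact K B N) +%R.
Proof.
move=> b x y; rewrite -[x]lreprK -[y]lreprK.
rewrite [LHS](_ : _ = lact b (lpi N (lrepr x + lrepr y))); last by rewrite [RHS]/= /lpi raddfD.
by rewrite !lact_lpi mulrDr /lpi raddfD.
Qed.

Lemma lactDl (x : lquot N) : {morph (fun b => lact b x) : b c / b + c}.
Proof. by move=> b c; rewrite -[x]lreprK !lact_lpi mulrDl /lpi raddfD. Qed.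

HB.instance Definition _ :=
  GRing.Zmodule_isLmodule.Build B M lactA lact1 lactDr lactDl.

End LeftIdealQuotient.

(** * The adjoint action and its signed divided powers *)

Section Adjoint.
Variables (K : fieldType) (B : algType K).
Implicit Types x y z : B.

Lemma ad_is_linear z : linear (@ad K B z).
Proof.
by move=> c x y; rewrite /ad mulrDr mulrDl -scalerAr -scalerAl opprD scalerBr addrACA.
Qed.
HB.instance Definition _ z := GRing.isLinear.Build K B B *:%R (@ad K B z) (@ad_is_linear z).

Lemma adZl c z x : ad (c *: z) x = c *: ad z x.
Proof. by rewrite /ad -scalerAl -scalerAr scalerBr. Qed.

Lemma adM z x y : ad z (x * y) = ad z x * y + x * ad z y.
Proof. by rewrite /ad mulrBl mulrBr !mulrA addrA subrK. Qed.

Lemma adE z x : z * x = x * z + ad z x.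
Proof. by rewrite /ad addrC subrK. Qed.

Lemma adC z x : ad z x = - ad x z.
Proof. by rewrite /ad opprB. Qed.

Lemma adxx z : ad z z = 0.
Proof. exact: subrr. Qed.

(** The Jacobi identity, in the form: [ad x] is a derivation of [ad]. *)
Lemma ad_ad x y z : ad x (ad y z) = ad (ad x y) z + ad y (ad x z).
Proof.
rewrite [ad y z]/ad linearB /= !adM [ad (ad x y) z]/ad [ad y (ad x z)]/ad.
by rewrite opprD [X in _ + X = _]addrC addrACA.
Qed.

Lemma iter_ad_is_linear n z : linear (iter n (@ad K B z)).
Proof. by move=> c x y; elim: n => //= n ->; rewrite linearP. Qed.
HB.instance Definition _ n z :=
  GRing.isLinear.Build K B B *:%R (iter n (@ad K B z)) (@iter_ad_is_linear n z).

Lemma iter_ad_ge z N n x : iter N (ad z) x = 0 -> (N <= n)%N -> iter n (ad z) x = 0.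
Proof. by move=> xN /subnK<-; rewrite iterD xN linear0. Qed.

End Adjoint.

Section TruncatedSums.
Variable V : zmodType.

Lemma sum_ord_trunc (F : nat -> V) m n : (m <= n)%N ->
  (forall k, (m <= k)%N -> F k = 0) -> \sum_(k < n) F k = \sum_(k < m) F k.
Proof.
move=> /subnKC<- F0; rewrite big_split_ord /= [X in _ + X]big1 ?addr0// => k _.
exact/F0/leq_addr.
Qed.

Lemma sum_triangle (G : nat -> nat -> V) n :
  \sum_(k < n) \sum_(j < k.+1) G j (k - j)%N = \sum_(j < n) \sum_(m < n - j) G j m.
Proof.
elim: n => [|n IH]; first by rewrite !big_ord0.
rewrite big_ord_recr /= IH [RHS]big_ord_recr /= [in RHS]subSnn big_ord1.
rewrite [X in _ + X]big_ord_recr /= subnn addrA; congr (_ + _).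
rewrite -big_split /=; apply: eq_bigr => j _.
by rewrite subSn 1?ltnW// big_ord_recr.
Qed.

Lemma sum_triangle_trunc (G : nat -> nat -> V) m n :
  (forall j k, (m <= j)%N -> G j k = 0) -> (forall j k, (n <= k)%N -> G j k = 0) ->
  \sum_(k < m + n) \sum_(j < k.+1) G j (k - j)%N = \sum_(j < m) \sum_(k < n) G j k.
Proof.
move=> Gm Gn; rewrite sum_triangle.
rewrite (@sum_ord_trunc (fun j => \sum_(k < m + n - j) G j k) m) ?leq_addr//; last first.
  by move=> j mj; rewrite big1// => k _; apply: Gm.
apply: eq_bigr => j _; apply: (@sum_ord_trunc (G j)) => [|k]; last exact: Gn.
by rewrite addnC -addnBA ?leq_addr// ltnW.
Qed.

End TruncatedSums.

Section SignedDividedPowers.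
Variables (K : numFieldType) (B : algType K) (z : B).
Implicit Types x y : B.

(** The coefficient of [t^n] in [exp (- t ad z) x]. *)
Definition signed_ad n x : B := ((-1) ^+ n / n`!%:R) *: iter n (ad z) x.

Lemma signed_ad_is_linear n : linear (signed_ad n).
Proof. by move=> c x y; rewrite /signed_ad linearP scalerDr !scalerA mulrC. Qed.
HB.instance Definition _ n :=
  GRing.isLinear.Build K B B *:%R (signed_ad n) (@signed_ad_is_linear n).

Lemma signed_ad0 x : signed_ad 0 x = x.
Proof. by rewrite /signed_ad fact0 expr0 divr1 scale1r. Qed.

Lemma signed_adS n x : n.+1%:R *: signed_ad n.+1 x = - ad z (signed_ad n x).
Proof.
rewrite /signed_ad iterS [in RHS]linearZ /= -scaleNr scalerA; congr (_ *: _).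
by rewrite factS natrM invfM mulrCA mulVKf ?pnatr_eq0// exprS mulN1r mulNr.
Qed.

Lemma signed_ad1 x : signed_ad 1 x = - ad z x.
Proof. by rewrite -[LHS]scale1r (signed_adS 0) signed_ad0. Qed.

Lemma signed_ad_eq0 N n x : iter N (ad z) x = 0 -> (N <= n)%N -> signed_ad n x = 0.
Proof. by move=> xN Nn; rewrite /signed_ad (iter_ad_ge xN Nn) scaler0. Qed.

(** Leibniz rule: [exp (- t ad z)] is multiplicative. *)
Lemma signed_adM n x y : signed_ad n (x * y) = \sum_(j < n.+1) signed_ad j x * signed_ad (n - j) y.
Proof.
elim: n => [|n IH]; first by rewrite big_ord1 !signed_ad0.
have n1 : n.+1%:R != 0 :> K by rewrite pnatr_eq0.
apply: (scalerI n1); rewrite signed_adS IH raddf_sum -sumrN scaler_sumr /=.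
transitivity (\sum_(j < n.+1) (j.+1%:R *: signed_ad j.+1 x * signed_ad (n - j) y) +
              \sum_(j < n.+1) (signed_ad j x * ((n - j).+1%:R *: signed_ad (n - j).+1 y))).
  rewrite -big_split /=; apply: eq_bigr => j _.
  by rewrite adM opprD !signed_adS mulNr mulrN.
transitivity (\sum_(j < n.+2) (j%:R *: signed_ad j x * signed_ad (n.+1 - j) y) +
              \sum_(j < n.+2) ((n.+1 - j)%:R *: (signed_ad j x * signed_ad (n.+1 - j) y))).
  congr (_ + _).
    by rewrite [RHS]big_ord_recl scale0r mul0r add0r; apply: eq_bigr => j _; rewrite subSS.
  rewrite [RHS]big_ord_recr /= subnn scale0r addr0; apply: eq_bigr => j _.
  by rewrite subSn ?scalerAr// -ltnS.
rewrite -big_split; apply: eq_bigr => j _ /=.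
by rewrite -scalerAl -scalerDl -natrD subnKC// -ltnS.
Qed.

End SignedDividedPowers.

(** * Roots and coroots *)

Section Roots.
Variables (K : numFieldType) (r : nat) (a : 'M[int]_r) (g : kacMoody K a).
Variable (d : 'I_r -> nat).
Hypotheses (a_cartan : generalized_cartan a) (a_sym : symmetrizes a d).
Implicit Types (n : 'rV[int]_r) (h : cartan g).

Definition alpha i h : K := sroot g i h.

Lemma alpha_is_linear i : linear_for *%R (alpha i).
Proof. by move=> c h h'; rewrite /alpha linearP. Qed.
HB.instance Definition _ i :=
  GRing.isLinear.Build K (cartan g) K *%R (alpha i) (@alpha_is_linear i).

Lemma alpha_coroot i j : alpha j (coroot g i) = (a i j)%:~R.
Proof. exact: sroot_coroot. Qed.

Lemma cartan_reflE i h : cartan_refl i h = h - alpha i h *: coroot g i.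
Proof. by []. Qed.

Lemma cartan_refl_is_linear i : linear (@cartan_refl K r a g i).
Proof.
move=> c h h'; rewrite !cartan_reflE linearP /= scalerBr scalerDl opprD addrACA.
by rewrite scalerA.
Qed.
HB.instance Definition _ i := GRing.isLinear.Build K (cartan g) (cartan g) *:%R
  (@cartan_refl K r a g i) (@cartan_refl_is_linear i).

Lemma alpha_cartan_refl i j h :
  alpha j (cartan_refl i h) = alpha j h - alpha i h * (a i j)%:~R.
Proof. by rewrite cartan_reflE linearB linearZ /= alpha_coroot. Qed.

Lemma alpha_cartan_refl_diag i h : alpha i (cartan_refl i h) = - alpha i h.
Proof.
by have [a2 _ _] := a_cartan; rewrite alpha_cartan_refl a2; ring.
Qed.

Lemma cartan_reflK i : involutive (@cartan_refl K r a g i).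
Proof.
move=> h; rewrite [LHS]cartan_reflE alpha_cartan_refl_diag scaleNr opprK.
by rewrite cartan_reflE subrK.
Qed.

Lemma root_val_refl i n h :
  root_val (lattice_refl a i n) h = root_val n (cartan_refl i h).
Proof.
rewrite /root_val.
transitivity (\sum_j ((n 0 j)%:~R * alpha j h -
   ((\sum_k a i k * n 0 k) * (j == i)%:R)%:~R * alpha j h)).
  apply: eq_bigr => j _; rewrite -mulrBl -rmorphB; congr (_%:~R * _).
  by rewrite /lattice_refl /simple_root !mxE eqxx.
rewrite sumrB [X in _ - X](bigD1 i) //= eqxx mulr1 [X in _ - (_ + X)]big1 ?addr0.
  rewrite rmorph_sum mulr_suml -sumrB; apply: eq_bigr => j _.
  by rewrite -!/(alpha _ _) alpha_cartan_refl; ring.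
by move=> j /negPf->; rewrite mulr0 mul0r.
Qed.

Lemma t_root_is_zmod_morphism : zmod_morphism (t_root g d).
Proof.
move=> n m; rewrite /t_root -sumrB; apply: eq_bigr => i _.
by rewrite !mxE mulrBl rmorphB scalerBl.
Qed.
HB.instance Definition _ :=
  GRing.isZmodMorphism.Build 'rV[int]_r (cartan g) (t_root g d) t_root_is_zmod_morphism.

Lemma t_root_simple i : t_root g d (simple_root i) = (d i)%:R *: coroot g i.
Proof.
rewrite /t_root (bigD1 i)//= big1 ?addr0; first by rewrite /simple_root mxE !eqxx mul1r.
by move=> j /negPf ji; rewrite /simple_root mxE eqxx ji mul0r scale0r.
Qed.

Lemma alpha_t_root i n :
  alpha i (t_root g d n) = (d i)%:R * (\sum_j a i j * n 0 j)%:~R.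
Proof.
have [_ sym] := a_sym; rewrite /t_root linear_sum rmorph_sum mulr_sumr.
apply: eq_bigr => j _; rewrite linearZ /= alpha_coroot -rmorphM.
rewrite -[(d i)%:R]/((d i)%:Z%:~R) -rmorphM; congr _%:~R.
by rewrite -mulrA -sym mulrC mulrA.
Qed.

Lemma t_root_refl i n :
  t_root g d (lattice_refl a i n) = cartan_refl i (t_root g d n).
Proof.
rewrite cartan_reflE alpha_t_root /lattice_refl raddfB /=; congr (_ - _).
have -> c m : t_root g d (c *: m) = c%:~R *: t_root g d m.
  by rewrite /t_root scaler_sumr; apply: eq_bigr => k _; rewrite mxE -mulrA rmorphM scalerA.
by rewrite t_root_simple scalerA mulrC.
Qed.

Lemma root_formE n m :
  (root_form a d n m)%:~R = root_val n (t_root g d m).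
Proof.
rewrite /root_form /root_val rmorph_sum; apply: eq_bigr => i _ /=.
rewrite -/(alpha _ _) alpha_t_root !rmorph_sum mulrA mulr_sumr.
apply: eq_bigr => j _.
by rewrite -[(d i)%:R]/((d i)%:Z%:~R) -!rmorphM /=; congr _%:~R; ring.
Qed.

(** [t] is equivariant for the Weyl group and [(n, n)] is invariant, so the
normalisation [2 t / (n, n)] only has to be compared with the coroot at a
simple root. *)
Lemma h_root_real (w : seq 'I_r) j :
  h_root g d (foldr (lattice_refl a) (simple_root j) w) =
  foldr (@cartan_refl K r a g) (coroot g j) w.
Proof.
have [a2 _ _] := a_cartan; have [d_gt0 _] := a_sym.
set n := foldr _ _ w.
have tE : t_root g d n = (d j)%:R *: foldr (@cartan_refl K r a g) (coroot g j) w.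
  rewrite /n; elim: w {n} => [|i w IH] /=; first exact: t_root_simple.
  by rewrite t_root_refl IH linearZ.
have fE : (root_form a d n n)%:~R = 2 * (d j)%:R :> K.
  rewrite root_formE /n; elim: w {n tE} => [|i w IH] /=.
    rewrite t_root_simple /root_val (bigD1 j)//= big1 ?addr0.
      by rewrite /simple_root mxE !eqxx mul1r -/(alpha _ _) linearZ /= alpha_coroot a2 mulrC.
    by move=> i /negPf ij; rewrite /simple_root mxE eqxx ij mul0r.
  by rewrite root_val_refl t_root_refl cartan_reflK.
rewrite /h_root asboolT; last by exists w, j.
have dj : (d j)%:R != 0 :> K by rewrite pnatr_eq0 -lt0n.
by rewrite fE tE scalerA invfM mulVKf ?pnatr_eq0// mulVf// scale1r.
Qed.

Lemma h_root_simple i : h_root g d (simple_root i) = coroot g i.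
Proof. exact: (h_root_real [::]). Qed.

Definition coroot_lattice h := exists c : 'I_r -> int,
  h = \sum_i (c i)%:~R *: coroot g i.

(** This integrality is what makes the set of denominators of [D] stable
under translation by integral weights. *)
Lemma h_root_lattice n : coroot_lattice (h_root g d n).
Proof.
rewrite /h_root; case: asboolP => [[w [j nE]]|_]; last by exists (fun i => n 0 i * (d i)%:Z).
have := h_root_real w j; rewrite -nE /h_root asboolT; last by exists w, j.
move=> ->; elim: w {nE} => [|i w [c IH]] /=.
  exists (fun i => (i == j)%:Z); rewrite (bigD1 j)//= eqxx scale1r big1 ?addr0//.
  by move=> i /negPf->; rewrite scale0r.
rewrite IH; exists (fun k => c k - (k == i)%:Z * (\sum_l c l * a l i)).
rewrite cartan_reflE linear_sum.
under [RHS]eq_bigr do rewrite rmorphB scalerBl.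
rewrite sumrB; congr (_ - _); rewrite [RHS](bigD1 i)//= eqxx mul1r [X in _ + X]big1 ?addr0.
  rewrite rmorph_sum; congr (_ *: _); apply: eq_bigr => l _.
  by rewrite linearZ /= alpha_coroot rmorphM.
by move=> k /negPf->; rewrite mul0r scale0r.
Qed.

(** Simple roots are linearly independent, so their values at a point of the
Cartan subalgebra can be prescribed. *)
Lemma exists_cartan_values (c : 'I_r -> K) : exists h, forall i, alpha i h = c i.
Proof.
pose b := vbasis {:cartan g}.
pose M := \matrix_(k < \dim {:cartan g}, i < r) alpha i b`_k.
have Mt : row_free M^T.
  apply: inj_row_free => u uM.
  have u_alpha h : \sum_i u 0 i * alpha i h = 0.
    rewrite (coord_vbasis (memvf h)).
    transitivity (\sum_k coord b k h * (u *m M^T) 0 k); last first.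
      by rewrite big1// => k _; rewrite uM mxE mulr0.
    under [LHS]eq_bigr do rewrite linear_sum mulr_sumr.
    rewrite exchange_big; apply: eq_bigr => k _; rewrite mxE mulr_sumr.
    by apply: eq_bigr => i _; rewrite !mxE linearZ /= mulrCA.
  have /freeP fr := sroot_free g; apply/rowP => i; rewrite mxE.
  apply: (fr (fun i => u 0 i)); apply/lfunP => h; rewrite sum_lfunE lfunE /=.
  rewrite -[RHS](u_alpha h); apply: eq_bigr => j _.
  by rewrite scale_lfunE (nth_map j) ?size_enum_ord// nth_ord_enum.
have /row_fullP[B BM] : row_full M by rewrite /row_full -mxrank_tr; exact: Mt.
have [x xM] : exists x : 'rV_(\dim {:cartan g}), x *m M = \row_i c i.
  by exists ((\row_i c i) *m B); rewrite -mulmxA BM mulmx1.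
exists (\sum_k x 0 k *: b`_k) => i; rewrite linear_sum.
transitivity ((x *m M) 0 i); last by rewrite xM mxE.
by rewrite [RHS]mxE; apply: eq_bigr => k _; rewrite linearZ /= mxE.
Qed.

End Roots.

(** * Triangular decompositions and weights *)

Section Span.
Variables (K : fieldType) (V : lmodType K).
Implicit Types G P : V -> Prop.

Definition lspan G z := forall P, submod_set P -> (forall y, G y -> P y) -> P z.

Lemma lspan_gen G z : G z -> lspan G z.
Proof. by move=> Gz P _; apply. Qed.

Lemma lspan_submod G : submod_set (lspan G).
Proof.
split=> [P [] //|c x y xG yG P PP GP]; have [_ PD] := PP.
by apply: PD; [apply: xG | apply: yG].
Qed.

Lemma submodD P x y : submod_set P -> P x -> P y -> P (x + y).
Proof. by move=> [_ PD] Px Py; rewrite -[x]scale1r; apply: PD. Qed.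

Lemma submodZ P c x : submod_set P -> P x -> P (c *: x).
Proof. by move=> [P0 PD] Px; rewrite -[_ *: _]addr0; apply: PD. Qed.

Lemma submodN P x : submod_set P -> P x -> P (- x).
Proof. by move=> PP Px; rewrite -scaleN1r; apply: submodZ. Qed.

End Span.

Section Triangular.
Variables (K : numFieldType) (U : algType K).
Implicit Types (u x y z : U) (X Y : U -> Prop).

Lemma left_ideal_submod Y : submod_set (fun u => u \in left_ideal Y).
Proof.
split=> [|c u v uJ vJ]; first by rewrite rpred0.
by rewrite rpredD// left_idealZ.
Qed.

(** The subalgebra generated by [X], built by left multiplications only. *)
Inductive word_span X : U -> Prop :=
| word_span1 : word_span X 1
| word_spanM x u : X x -> word_span X u -> word_span X (x * u)
| word_spanL c u v : word_span X u -> word_span X v -> word_span X (c *: u + v).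

Lemma word_span_submod X : submod_set (word_span X).
Proof.
split=> [|c u v]; last exact: word_spanL.
by rewrite -(addNr 1) -scaleN1r; apply: word_spanL; apply: word_span1.
Qed.

Definition triangular X Y u := exists b j,
  [/\ word_span X b, j \in left_ideal Y & u = b + j].

Lemma triangular_submod X Y : submod_set (triangular X Y).
Proof.
have [X0 XD] := word_span_submod X; have [Y0 YD] := left_ideal_submod Y.
split=> [|c _ _ [b [j [Xb Yj ->]]] [b' [j' [Xb' Yj' ->]]]].
  by exists 0, 0; rewrite addr0.
exists (c *: b + b'), (c *: j + j'); split; [exact: XD|exact: YD|].
by rewrite scalerDr addrACA.
Qed.

Lemma triangular1 X Y : triangular X Y 1.
Proof. by exists 1, 0; split; [apply: word_span1|apply: rpred0|rewrite addr0]. Qed.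

(** An element of [Y] is moved to the right of a word in [X]; each
commutation produces a commutator, which by assumption is again a
combination of elements of [X] and [Y] acting on a shorter word. *)
Lemma triangular_mul X Y :
  (forall x y, X x -> Y y -> lspan (fun z => X z \/ Y z) (ad y x)) ->
  forall z u, X z \/ Y z -> triangular X Y u -> triangular X Y (z * u).
Proof.
move=> XY; have TP := triangular_submod X Y.
have TX x u : X x -> triangular X Y u -> triangular X Y (x * u).
  move=> Xx [b [j [Xb Yj ->]]]; exists (x * b), (x * j).
  by split; [apply: word_spanM|apply: left_idealM|rewrite mulrDr].
have TJ u : u \in left_ideal Y -> triangular X Y u.
  by move=> uJ; exists 0, u; split; rewrite ?add0r//; case: (word_span_submod X).
have TY y b : word_span X b -> Y y -> triangular X Y (y * b).
  move=> Xb; elim: b / Xb y => [|x b Xx Xb IH|c b b' _ IH _ IH'] y Yy.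
  - by rewrite mulr1; apply/TJ/mem_left_ideal.
  - rewrite mulrA [y * x]adE mulrDl -mulrA; apply: submodD => //; first exact/TX/IH.
    apply: (XY x y Xx Yy (fun z => triangular X Y (z * b))) => [|z [Xz|Yz]].
    + split=> [|c z z' Tz Tz']; first by rewrite mul0r; case: TP.
      by rewrite mulrDl -scalerAl; case: TP => _; apply.
    + by apply: TX => //; exists b, 0; split; rewrite ?rpred0 ?addr0.
    + exact: IH.
  - by rewrite mulrDr -scalerAr; case: TP => _; apply; [apply: IH|apply: IH'].
move=> z u [Xz|Yz]; first exact: TX.
move=> [b [j [Xb Yj ->]]]; rewrite mulrDr; apply: submodD => //; first exact: TY.
exact/TJ/left_idealM.
Qed.

Section Eigen.
Variable H : U.

(** The product [(ad H) (ad H + 1) ... (ad H + n - 1)], which kills the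
eigenvectors of eigenvalue [0, -1, ..., 1 - n]. *)
Definition shifted_ad n u : U := iteri n (fun k v => ad H v + k%:R *: v) u.

Lemma shifted_adS n u :
  shifted_ad n.+1 u = ad H (shifted_ad n u) + n%:R *: shifted_ad n u.
Proof. by []. Qed.

Lemma shifted_ad_is_linear n : linear (shifted_ad n).
Proof.
move=> c u v; elim: n => // n IH; rewrite !shifted_adS IH linearP /= !scalerDr.
by rewrite addrACA !scalerA [n%:R * _]mulrC.
Qed.
HB.instance Definition _ n :=
  GRing.isLinear.Build K U U *:%R (shifted_ad n) (@shifted_ad_is_linear n).

Lemma shifted_ad_eigen n c u : ad H u = c *: u ->
  shifted_ad n u = (\prod_(k < n) (c + k%:R)) *: u.
Proof.
move=> uc; elim: n => [|n IH]; first by rewrite big_ord0 scale1r.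
rewrite shifted_adS IH linearZ /= uc !scalerA -scalerDl big_ord_recr /=.
by rewrite mulrDr [n%:R * _]mulrC.
Qed.

Definition nonpos_eigen u := exists m : nat, ad H u = - m%:R *: u.

Lemma word_span_killed X u : (forall x, X x -> nonpos_eigen x) -> word_span X u ->
  exists N, forall n, (N <= n)%N -> shifted_ad n u = 0.
Proof.
move=> XH Xu; have : lspan nonpos_eigen u.
  elim: u / Xu => [|x u Xx Xu IH|c u v _ IH _ IH'].
  - by apply: lspan_gen; exists 0%N; rewrite /ad mulr1 mul1r subrr oppr0 scale0r.
  - apply: (IH (fun u => lspan nonpos_eigen (x * u))) => [|v [m vm]].
      have [P0 PD] := lspan_submod nonpos_eigen.
      by split=> [|c v w xv xw]; rewrite ?mulr0// mulrDr -scalerAr; apply: PD.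
    have [k xk] := XH x Xx; apply: lspan_gen; exists (k + m)%N.
    by rewrite adM xk vm -scalerAl -scalerAr -scalerDl natrD opprD.
  - by have [_ PD] := lspan_submod nonpos_eigen; apply: PD.
move/(_ (fun u => exists N, forall n, (N <= n)%N -> shifted_ad n u = 0)).
apply=> [|v [m vm]]; first split=> [|c v w [N vN] [N' wN]].
- by exists 0%N => n _; rewrite linear0.
- exists (maxn N N') => n; rewrite geq_max => /andP[Nn N'n].
  by rewrite linearP /= vN// wN// scaler0 addr0.
exists m.+1 => n mn; rewrite (shifted_ad_eigen n vm) (bigD1 (Ordinal mn)) //=.
by rewrite addNr mul0r scale0r.
Qed.

Lemma left_ideal_shifted Y n u : (forall y, Y y -> exists c, ad H y = c *: y) ->
  u \in left_ideal Y -> shifted_ad n u \in left_ideal Y.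
Proof.
move=> YH uJ; elim: n => // n IH; rewrite shifted_adS rpredD ?left_idealZ//.
elim/left_ideal_ind: IH => [|v w|b z Yz]; first by rewrite linear0 rpred0.
  by rewrite linearD; apply: rpredD.
have [c zc] := YH z Yz; rewrite adM zc -scalerAr rpredD ?left_idealZ//;
  exact/left_idealM/mem_left_ideal.
Qed.

(** Write [u = b + j] with [b] a combination of words in [X] and [j] in the
left ideal. For large [n], [shifted_ad n] kills [b], preserves the ideal, and
multiplies [u] by the nonzero scalar [c (c + 1) ... (c + n - 1)]. *)
Lemma triangular_pos_eigen X Y u c : (forall x, X x -> nonpos_eigen x) ->
  (forall y, Y y -> exists c, ad H y = c *: y) ->
  triangular X Y u -> 0 < c -> ad H u = c *: u -> u \in left_ideal Y.
Proof.
move=> XH YH [b [j [Xb Yj uE]]] c0 uc.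
have [N bN] := word_span_killed XH Xb; have := shifted_ad_eigen N uc.
rewrite {1}uE linearD /= bN// add0r => jE.
set p := \prod_(k < N) _ in jE.
have p0 : p != 0 by apply/prodf_neq0 => k _; rewrite gt_eqF// ltr_wpDr.
rewrite -[u]scale1r -(mulVf p0) -scalerA -jE left_idealZ//.
exact: left_ideal_shifted.
Qed.

End Eigen.
End Triangular.

(** * Positive weights in the enveloping algebra *)

Lemma rmorph_ad (K : fieldType) (B C : algType K) (f : {lrmorphism B -> C}) y z :
  f (ad y z) = ad (f y) (f z).
Proof. by rewrite /ad rmorphB !rmorphM. Qed.

Lemma left_ideal_map (K : fieldType) (B C : algType K) (f : {lrmorphism B -> C})
    (N : B -> Prop) (N' : C -> Prop) :
  (forall z, N z -> f z \in left_ideal N') ->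
  forall u, u \in left_ideal N -> f u \in left_ideal N'.
Proof.
move=> NN' u; elim/left_ideal_ind => [|v w|b z /NN' zN].
- by rewrite rmorph0 rpred0.
- by rewrite rmorphD; apply: rpredD.
by rewrite rmorphM; apply: left_idealM.
Qed.

Section Relations.
Variables (K : numFieldType) (r : nat) (a : 'M[int]_r) (g : kacMoody K a).
Variables (B : algType K) (x : {linear g -> B}).
Hypothesis x_bracket : forall u v, x (bracket u v) = x u * x v - x v * x u.
Local Notation H h := (x (cartan_in g h)).
Local Notation E i := (x (gen_e g i)).
Local Notation F i := (x (gen_f g i)).
Implicit Types (h : cartan g) (i j : 'I_r) (y z w : B).

Lemma ad_lie u v : ad (x u) (x v) = x (bracket u v).
Proof. by rewrite x_bracket. Qed.

Lemma ad_lie_iter k u v : iter k (ad (x u)) (x v) = x (iter k (bracket u) v).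
Proof. by elim: k => //= k ->; rewrite ad_lie. Qed.

Lemma ad_HH h h' : ad (H h) (H h') = 0.
Proof. by rewrite ad_lie bracket_hh linear0. Qed.

Lemma ad_HE h j : ad (H h) (E j) = alpha j h *: E j.
Proof. by rewrite ad_lie bracket_he linearZ. Qed.

Lemma ad_HF h j : ad (H h) (F j) = - alpha j h *: F j.
Proof. by rewrite ad_lie bracket_hf linearN linearZ scaleNr. Qed.

Lemma ad_EF i j : ad (E i) (F j) = if i == j then H (coroot g i) else 0.
Proof. by rewrite ad_lie bracket_ef; case: eqP => // _; rewrite linear0. Qed.

Lemma lie_ind (P : B -> Prop) : submod_set P ->
  (forall y z, P y -> P z -> P (ad y z)) ->
  (forall h, P (H h)) -> (forall j, P (E j)) -> (forall j, P (F j)) ->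
  forall u : g, P (x u).
Proof.
move=> PP Pad PH PE PF u.
apply: (@km_generated _ _ _ g u (fun v => P (x v))) => [|y]; last first.
  by case=> [[h ->]|[i [->|->]]].
split=> [|y z Py Pz]; last by rewrite -ad_lie; apply: Pad.
split=> [|c y z Py Pz]; first by rewrite linear0; case: PP.
by rewrite linearP; case: PP => _; apply.
Qed.

Lemma eigen_ad z c c' y w : ad z y = c *: y -> ad z w = c' *: w ->
  ad z (ad y w) = (c + c') *: ad y w.
Proof.
by move=> yc wc; rewrite ad_ad yc wc linearZ /= adZl scalerDl.
Qed.

Lemma eigen_iter_ad z c c' y w k : ad z y = c *: y -> ad z w = c' *: w ->
  ad z (iter k (ad y) w) = (c' + k%:R * c) *: iter k (ad y) w.
Proof.
move=> yc wc; elim: k => [|k IH]; first by rewrite mul0r addr0.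
rewrite (eigen_ad yc IH); congr (_ *: _).
by rewrite -natr1; ring.
Qed.

Lemma serre_iter_E i j k : i != j -> (`|1 - a i j|%N <= k)%N ->
  iter k (ad (E i)) (E j) = 0.
Proof. by move=> ij; apply: iter_ad_ge; rewrite ad_lie_iter serre_e ?linear0. Qed.

Lemma serre_iter_F i j k : i != j -> (`|1 - a i j|%N <= k)%N ->
  iter k (ad (F i)) (F j) = 0.
Proof. by move=> ij; apply: iter_ad_ge; rewrite ad_lie_iter serre_f ?linear0. Qed.

(** [e_j] is a lowest weight vector for the sl2 of the simple root [i], so
[f_i] moves down the string generated from it by [ad e_i]. *)
Lemma ad_F_string i j k : i != j ->
  exists c : K, ad (F i) (iter k.+1 (ad (E i)) (E j)) = c *: iter k (ad (E i)) (E j).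
Proof.
move=> ij; have fe : ad (F i) (E i) = - H (coroot g i) by rewrite adC ad_EF eqxx.
have hk m := eigen_iter_ad m (ad_HE (coroot g i) i) (ad_HE (coroot g i) j).
elim: k => [|k [c IH]].
  exists (- alpha j (coroot g i)); rewrite /= ad_ad fe [ad (F i) (E j)]adC ad_EF.
  rewrite eq_sym (negPf ij) oppr0 linear0 addr0.
  by rewrite scaleNr -ad_HE adC [in RHS]adC linearN.
exists (c - (alpha j (coroot g i) + k.+1%:R * alpha i (coroot g i))).
rewrite iterS ad_ad fe IH linearZ /= -iterS scalerBl addrC -hk; congr (_ + _).
by rewrite adC [in RHS]adC linearN.
Qed.

Lemma ad_F_string0 i j : i != j -> ad (F i) (E j) = 0.
Proof. by move=> ij; rewrite adC ad_EF eq_sym (negPf ij) oppr0. Qed.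

Lemma ad_F_string_other i j k m : m != i ->
  ad (F m) (iter k (ad (E i)) (E j)) = iter k (ad (E i)) (ad (F m) (E j)).
Proof.
move=> mi; elim: k => // k IH; rewrite !iterS ad_ad IH ad_F_string0//.
by rewrite [ad 0 _]adC linear0 oppr0 add0r.
Qed.

End Relations.

Section PositivePart.
Variables (K : numFieldType) (r : nat) (a : 'M[int]_r) (g : kacMoody K a).
Variables (U : algType K) (iU : {linear g -> U}).
Hypotheses (a_cartan : generalized_cartan a) (U_env : is_enveloping (@bracket _ g) iU).
Local Notation H h := (iU (cartan_in g h)).
Local Notation E i := (iU (gen_e g i)).
Local Notation F i := (iU (gen_f g i)).

Let iU_bracket u v : iU (bracket u v) = iU u * iU v - iU v * iU u.
Proof. by case: U_env => iH _; apply: iH. Qed.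

Lemma enveloping_left_ind (S : U -> Prop) : submod_set S -> S 1 ->
  (forall h u, S u -> S (H h * u)) -> (forall j u, S u -> S (E j * u)) ->
  (forall j u, S u -> S (F j * u)) -> forall u, S u.
Proof.
move=> SP S1 SH SE SF u.
(* The elements that preserve [S] form a subalgebra. *)
pose St u := forall v, S v -> S (u * v).
have StP : submod_set St.
  split=> [v _|c y z Sy Sz v Sv]; first by rewrite mul0r; case: SP.
  by rewrite mulrDl -scalerAl; case: SP => _; apply; [apply: Sy|apply: Sz].
rewrite -[u]mulr1; apply: (enveloping_ind (S := St) U_env) S1 => //.
- by move=> v; rewrite mul1r.
- by move=> y z Sy Sz v Sv; rewrite -mulrA; apply/Sy/Sz.
apply: (lie_ind iU_bracket) => // y z Sy Sz v Sv.
rewrite /ad mulrBl; apply: submodD => //; first by rewrite -mulrA; apply/Sy/Sz.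
by apply: submodN => //; rewrite -mulrA; apply/Sz/Sy.
Qed.

Definition raising z := exists j, z = E j.

(** The decomposition [U = U(b_-) + U n]: [U(b_-)] only has weights [<= 0]
under [h]. *)
Lemma pos_weight_raising h u c : (forall j, alpha j h = 1) -> 0 < c ->
  ad (H h) u = c *: u -> u \in left_ideal raising.
Proof.
move=> h1 c0 uc.
pose X z := (exists h', z = H h') \/ (exists j, z = F j).
apply: (@triangular_pos_eigen _ _ (H h) X) c0 uc.
- move=> _ [[h' ->]|[j ->]].
    by exists 0%N; rewrite (ad_HH iU_bracket) oppr0 scale0r.
  by exists 1%N; rewrite (ad_HF iU_bracket) h1.
- by move=> _ [j ->]; exists 1; rewrite (ad_HE iU_bracket) h1.
pose L := lspan (fun z => X z \/ raising z).
have LP : submod_set L by apply: lspan_submod.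
have LZ k w : L w -> L (k *: w) by apply: submodZ.
have LN w : L w -> L (- w) by apply: submodN.
have LX w : X w -> L w by move=> Xw; apply: lspan_gen; left.
have LY w : raising w -> L w by move=> Yw; apply: lspan_gen; right.
have XY z v : X z \/ raising z -> triangular X raising v -> triangular X raising (z * v).
  apply: triangular_mul => _ _ [[h' ->]|[j ->]] [k ->]; rewrite -/L.
    rewrite adC (ad_HE iU_bracket) -scaleNr; apply: (LZ).
    by apply: (LY); exists k.
  rewrite (ad_EF iU_bracket); case: eqP => _; last by case: LP.
  by apply: (LX); left; exists (coroot g k).
apply: (enveloping_left_ind (triangular_submod X raising)) => [|h' v|j v|j v];
  first exact: triangular1.
- by apply: XY; left; left; exists h'.
- by apply: XY; right; exists j.
- by apply: XY; left; right; exists j.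
Qed.

Section Reflected.
Variable i : 'I_r.

(** Generators of the left ideal generated by the reflection [s_i(n)], whose
roots are [- alpha_i] and the positive roots other than [alpha_i]. *)
Definition reflected_raising z := z = F i \/
  exists j k, i != j /\ z = iter k (ad (E i)) (E j).

Let Ystr z := exists j k, i != j /\ z = iter k (ad (E i)) (E j).
Let Xpar z := [\/ exists h, z = H h, exists j, z = F j | z = E i].
Let Xref z := [\/ exists h, z = H h, z = E i |
  exists j k, i != j /\ z = iter k (ad (F i)) (F j)].

(** First step of the reflected decomposition: [Xpar] generates the opposite
parabolic subalgebra, and the strings [Ystr] the complementary nilradical. *)
Let parabolic_mul z u : Xpar z \/ Ystr z ->
  triangular Xpar Ystr u -> triangular Xpar Ystr (z * u).
Proof.
pose L := lspan (fun z => Xpar z \/ Ystr z).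
have LP : submod_set L by apply: lspan_submod.
have LZ k w : L w -> L (k *: w) by apply: submodZ.
have LN w : L w -> L (- w) by apply: submodN.
have LX w : Xpar w -> L w by move=> Xw; apply: lspan_gen; left.
have LY w : Ystr w -> L w by move=> Yw; apply: lspan_gen; right.
apply: triangular_mul => x y Xx [j [k [ij ->]]]; rewrite -/L adC; apply: (LN).
case: Xx => [[h ->]|[m ->]|->].
- rewrite (eigen_iter_ad _ (ad_HE iU_bracket h i) (ad_HE iU_bracket h j)).
  by apply: (LZ); apply: (LY); exists j, k.
- have [->|mi] := eqVneq m i.
    case: k => [|k]; first by rewrite (ad_F_string0 iU_bracket)//; case: LP.
    have [c ->] := ad_F_string iU_bracket k ij.
    by apply: (LZ); apply: (LY); exists j, k.
  rewrite (ad_F_string_other iU_bracket)// adC (ad_EF iU_bracket).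
  case: (j == m); last by rewrite oppr0 linear0; case: LP.
  have -> : iter k (ad (E i)) (- H (coroot g j)) = - iter k (ad (E i)) (H (coroot g j)).
    by rewrite linearN.
  apply: (LN).
  case: k => [|[|k]]; first by apply: (LX); constructor 1; exists (coroot g j).
    rewrite /= adC (ad_HE iU_bracket); apply: (LN); apply: (LZ).
    by apply: (LX); constructor 3.
  rewrite !iterSr /= [ad (E i) (H _)]adC (ad_HE iU_bracket) linearN linearZ /= adxx.
  by rewrite scaler0 oppr0 linear0; case: LP.
- by rewrite -iterS; apply: (LY); exists j, k.+1.
Qed.

(** Second step: inside the enveloping algebra of the parabolic, [f_i] is
moved to the right of the remaining generators [Xref]. *)
Let reflected_mul z u : Xref z \/ z = F i ->
  triangular Xref (eq^~ (F i)) u -> triangular Xref (eq^~ (F i)) (z * u).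
Proof.
pose L := lspan (fun z => Xref z \/ z = F i).
have LP : submod_set L by apply: lspan_submod.
have LZ k w : L w -> L (k *: w) by apply: submodZ.
have LN w : L w -> L (- w) by apply: submodN.
have LX w : Xref w -> L w by move=> Xw; apply: lspan_gen; left.
have LY : L (F i) by apply: lspan_gen; right.
apply: triangular_mul => x _ Xx ->; rewrite -/L.
case: Xx => [[h ->]|->|[j [k [ij ->]]]].
- rewrite adC (ad_HF iU_bracket) -scaleNr; apply: (LZ).
  by apply: (LY).
- rewrite adC (ad_EF iU_bracket) eqxx; apply: (LN); apply: (LX).
  by constructor 1; exists (coroot g i).
- by rewrite -iterS; apply: (LX); constructor 3; exists j, k.+1.
Qed.

Let reflected_triangular u : exists b w, [/\ word_span Xref b,
  w \in left_ideal reflected_raising & u = b + w].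
Proof.
have Xsub z : Xpar z -> Xref z \/ z = F i.
  case=> [[h ->]|[j ->]|->]; first by left; constructor 1; exists h.
    have [->|ij] := eqVneq j i; first by right.
    by left; constructor 3; exists j, 0%N; rewrite eq_sym.
  by left; constructor 2.
have Xpar_ref b : word_span Xpar b -> triangular Xref (eq^~ (F i)) b.
  elim=> [|z v Xz _ IH|c v w _ IHv _ IHw]; first exact: triangular1.
    by apply: reflected_mul => //; apply: Xsub.
  by case: (triangular_submod Xref (eq^~ (F i))) => _; apply.
have sub1 w : w \in left_ideal (eq^~ (F i)) -> w \in left_ideal reflected_raising.
  elim/left_ideal_ind=> [|v v'|b z ->]; rewrite ?rpred0//; first exact: rpredD.
  by apply/left_idealM/mem_left_ideal; left.
have sub2 w : w \in left_ideal Ystr -> w \in left_ideal reflected_raising.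
  elim/left_ideal_ind=> [|v v'|b z Yz]; rewrite ?rpred0//; first exact: rpredD.
  by apply/left_idealM/mem_left_ideal; right.
have [b [w [Xb wY ->]]] : triangular Xpar Ystr u.
  apply: (enveloping_left_ind (triangular_submod Xpar Ystr)) => [|h' v|j v|j v];
    first exact: triangular1.
  - by apply: parabolic_mul; left; constructor 1; exists h'.
  - have [->|ij] := eqVneq j i; first by apply: parabolic_mul; left; constructor 3.
    by apply: parabolic_mul; right; exists j, 0%N; rewrite eq_sym.
  - by apply: parabolic_mul; left; constructor 2; exists j.
have [b' [w' [Xb' wY' ->]]] := Xpar_ref b Xb.
by exists b', (w' + w); rewrite addrA; split=> //; apply: rpredD; [apply: sub1|apply: sub2].
Qed.

(** At [s_i h] the simple root [alpha_j] takes the value [1 - a_ij] and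
[alpha_i] the value [-1]. By the Serre relations a nonzero
[(ad e_i)^k e_j] has [k <= - a_ij], so its weight [1 - a_ij - k] is
positive. *)
Lemma reflected_raising_weight h z : (forall j, alpha j h = 1) ->
  reflected_raising z -> z = 0 \/
  exists2 c : K, 0 < c & ad (H (cartan_refl i h)) z = c *: z.
Proof.
move=> h1; have [a2 aneg _] := a_cartan.
have ai j : alpha j (cartan_refl i h) = 1 - (a i j)%:~R.
  by rewrite alpha_cartan_refl !h1 mul1r.
case=> [->|[j [k [ij ->]]]].
  by right; exists 1; rewrite ?ltr01// (ad_HF iU_bracket) ai a2; congr (_ *: _); ring.
have [ak|ak] := leqP `|1 - a i j|%N k.
  by left; rewrite (serre_iter_E iU_bracket ij ak).
(* Serre: [k < 1 - a_ij]. *)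
right; exists (1 - (a i j)%:~R + k%:R * (1 - (a i i)%:~R)); last first.
  rewrite (eigen_iter_ad _ (ad_HE iU_bracket _ i) (ad_HE iU_bracket _ j)).
  by rewrite !ai.
have k_le : k%:Z <= - a i j by have := aneg _ _ ij; move: ak; lia.
have [l lE] : exists l : nat, - a i j = k%:Z + l%:Z.
  by exists `|- a i j - k%:Z|%N; lia.
rewrite a2 [X in 0 < X](_ : _ = l.+1%:R) ?ltr0Sn//.
by rewrite -[a i j]opprK lE -natr1; ring.
Qed.

Lemma pos_weight_reflected_raising h u c : (forall j, alpha j h = 1) -> 0 < c ->
  ad (H (cartan_refl i h)) u = c *: u -> u \in left_ideal reflected_raising.
Proof.
move=> h1 c0 uc; have [a2 aneg _] := a_cartan.
have ai j : alpha j (cartan_refl i h) = 1 - (a i j)%:~R.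
  by rewrite alpha_cartan_refl !h1 mul1r.
apply: (@triangular_pos_eigen _ _ (H (cartan_refl i h)) Xref) c0 uc.
- move=> z [[h' ->]|->|[j [k [ij ->]]]].
  + by exists 0%N; rewrite (ad_HH iU_bracket) oppr0 scale0r.
  + by exists 1%N; rewrite (ad_HE iU_bracket) ai a2; congr (_ *: _); ring.
  have [ak|ak] := leqP `|1 - a i j|%N k.
    by exists 0%N; rewrite (serre_iter_F iU_bracket ij ak) linear0 scaler0.
  have k_le : k%:Z <= - a i j by have := aneg _ _ ij; move: ak; lia.
  have [l lE] : exists l : nat, - a i j = k%:Z + l%:Z.
    by exists `|- a i j - k%:Z|%N; lia.
  exists l.+1; rewrite (eigen_iter_ad _ (ad_HF iU_bracket _ i) (ad_HF iU_bracket _ j)).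
  rewrite !ai a2 -[a i j]opprK lE -natr1; congr (_ *: _); ring.
- by move=> z /(reflected_raising_weight h1)[->|[c' _ zc]];
    [exists 0; rewrite linear0 scaler0|exists c'].
exact: reflected_triangular.
Qed.

End Reflected.

Section BraidAutomorphism.
Variables (i : 'I_r) (T : {lrmorphism U -> U}).
Hypothesis T_cartan : forall h, T (H h) = H (cartan_refl i h).

(** [T] sends the weight 1 of [e_j] under [h] to the weight 1 under
[s_i h]. *)
Lemma automorphism_raising j : T (E j) \in left_ideal (reflected_raising i).
Proof.
have [h h1] := exists_cartan_values g (fun=> 1).
apply: (pos_weight_reflected_raising h1 ltr01).
by rewrite -T_cartan -rmorph_ad (ad_HE iU_bracket) h1 !scale1r.
Qed.

(** The converse inclusion, by the same argument for the inverse of [T]. *)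
Lemma reflected_raising_automorphism z : bijective T -> reflected_raising i z ->
  z \in left_ideal (fun y => exists j, y = T (E j)).
Proof.
move=> [T1 T1K TK1]; have [h h1] := exists_cartan_values g (fun=> 1).
case/(reflected_raising_weight h1) => [->|[c c0 zc]]; first exact: rpred0.
have : T1 z \in left_ideal raising.
  apply: (pos_weight_raising h1 c0); apply: (can_inj T1K).
  by rewrite rmorph_ad T_cartan TK1 zc linearZ /= TK1.
rewrite -{2}[z]TK1; apply: left_ideal_map => _ [j ->].
by apply: mem_left_ideal; exists j.
Qed.

End BraidAutomorphism.
End PositivePart.

(** * Local nilpotence and integral weights *)

Section Sl2.
Variables (K : numFieldType) (V : lmodType K) (e f : {linear V -> V}) (h : V -> V).
Hypothesis ef : forall x, e (f x) = f (e x) + h x.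
Hypothesis he : forall x, h (e x) = e (h x) + (e x) *+ 2.
Hypothesis hf : forall x, h (f x) = f (h x) - (f x) *+ 2.
Hypothesis e_nil : forall x, exists n, iter n e x = 0.
Hypothesis f_nil : forall x, exists n, iter n f x = 0.

Lemma last_nonzero_iter (t : V -> V) x : x != 0 -> (exists n, iter n t x = 0) ->
  exists n, iter n t x != 0 /\ t (iter n t x) = 0.
Proof.
move=> x0 [n tn]; have ex : exists n, iter n t x == 0 by exists n; apply/eqP.
case: (ex_minnP ex) => [[|m]] /eqP tm mmin; first by rewrite /= in tm; rewrite tm eqxx in x0.
by exists m; split => //; apply/negP => /mmin; rewrite ltnn.
Qed.

(** Climbing with [e] from [x] reaches a highest weight vector [y] of weight
[mu + 2 n]. Descending with [f] ends too, after some [m] steps, and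
[e f^(m+1) y = (m + 1) (mu + 2 n - m) f^m y] forces [mu + 2 n = m]. *)
Lemma sl2_integral x mu : x != 0 -> h x = mu *: x -> exists m : int, mu = m%:~R.
Proof.
move=> x0 hx.
have [n [y0 ey]] := last_nonzero_iter x0 (e_nil x).
set y := iter n e x in y0 ey; pose la := mu + (n.*2)%:R.
have hy : h y = la *: y.
  rewrite /y /la; elim: (n) => [|m IH] /=; first by rewrite addr0.
  rewrite he IH linearZ -scaler_nat -scalerDl; congr (_ *: _).
  by rewrite doubleS -(addn2 m.*2) natrD; ring.
have hfy m : h (iter m f y) = (la - (m.*2)%:R) *: iter m f y.
  elim: m => [|m IH] /=; first by rewrite subr0.
  rewrite hf IH linearZ -scaler_nat -scalerBl; congr (_ *: _).
  by rewrite doubleS -(addn2 m.*2) natrD; ring.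
have efy m : e (iter m.+1 f y) = (m.+1%:R * (la - m%:R)) *: iter m f y.
  elim: m => [|m IH]; first by rewrite /= ef ey hy linear0 add0r mul1r subr0.
  rewrite iterS ef IH hfy linearZ -iterS -scalerDl; congr (_ *: _).
  by rewrite -addnn natrD -[m.+2%:R]natr1 -[m.+1%:R]natr1; ring.
have [m [fm0 fm]] := last_nonzero_iter y0 (f_nil y).
have := efy m; rewrite iterS fm linear0 => /esym/eqP.
rewrite scaler_eq0 (negPf fm0) orbF mulf_eq0 pnatr_eq0 /= subr_eq0 => /eqP laE.
exists (m%:Z - (n.*2)%:Z); rewrite rmorphB /= -[m%:~R]/(m%:R : K) -laE.
by rewrite /la addrK.
Qed.

End Sl2.

Section LocallyNilpotent.
Variables (K : numFieldType) (B : algType K) (z : B).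

Definition ad_nilpotent x := exists n, iter n (ad z) x = 0.

Lemma ad_nilpotent_submod : submod_set ad_nilpotent.
Proof.
split=> [|c x y [n xn] [m ym]]; first by exists 0%N.
exists (n + m)%N; rewrite linearP /= (iter_ad_ge xn) ?leq_addr//.
by rewrite (iter_ad_ge ym) ?leq_addl// scaler0 addr0.
Qed.

Lemma ad_nilpotentM x y : ad_nilpotent x -> ad_nilpotent y -> ad_nilpotent (x * y).
Proof.
move=> [n xn] [m ym]; exists (n + m)%N.
have : signed_ad z (n + m) (x * y) = 0.
  rewrite signed_adM big1// => j _; have [nj|jn] := leqP n j.
    by rewrite (signed_ad_eq0 xn nj) mul0r.
  have jle : (j <= n + m)%N by rewrite -ltnS.
  by rewrite (signed_ad_eq0 ym) ?mulr0// -(leq_add2l j) subnKC// leq_add2r ltnW.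
rewrite /signed_ad => /eqP; rewrite scaler_eq0 => /orP[|/eqP//].
by rewrite mulf_eq0 invr_eq0 pnatr_eq0 (gtn_eqF (fact_gt0 _)) orbF signr_eq0.
Qed.

Lemma ad_nilpotent_ad x y : ad_nilpotent x -> ad_nilpotent y -> ad_nilpotent (ad x y).
Proof.
move=> xn yn; apply: submodD; first exact: ad_nilpotent_submod.
  exact: ad_nilpotentM.
by apply: submodN; [exact: ad_nilpotent_submod|exact: ad_nilpotentM].
Qed.

End LocallyNilpotent.

Section Admissible.
Variables (K : numFieldType) (r : nat) (a : 'M[int]_r) (g : kacMoody K a).
Variables (U A : algType K) (iU : {linear g -> U}) (jA : {lrmorphism U -> A}).
Hypotheses (a_cartan : generalized_cartan a) (U_env : is_enveloping (@bracket _ g) iU).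
Hypothesis A_adm : admissible iU jA.
Variable gA : {linear g -> A}.
Hypothesis gAE : forall u, gA u = jA (iU u).
Local Notation H h := (gA (cartan_in g h)).
Local Notation E i := (gA (gen_e g i)).
Local Notation F i := (gA (gen_f g i)).

Lemma gA_bracket u v : gA (bracket u v) = gA u * gA v - gA v * gA u.
Proof. by case: U_env => iH _; rewrite !gAE iH rmorphB !rmorphM. Qed.

(** Local nilpotence on [V] is part of admissibility; on [U(g)] it follows
from nilpotence on generators of [g], since locally nilpotent elements form a
subalgebra. *)
Lemma admissible_ad_nilpotent (u : g) n : real_root a n -> weight_space n u ->
  (forall h, ad_nilpotent (gA u) (H h)) -> (forall j, ad_nilpotent (gA u) (E j)) ->
  (forall j, ad_nilpotent (gA u) (F j)) -> forall x, ad_nilpotent (gA u) x.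
Proof.
move=> n_re u_n uH uE uF x.
have nP := ad_nilpotent_submod (gA u).
have [_ [V [v [_ [_ [UV _] Vnil _]]]]] := A_adm.
apply: (tensor_ind UV) x => // y w; apply: ad_nilpotentM; last first.
  by have [N wN] := Vnil n u w n_re u_n; exists N; rewrite gAE.
apply: (enveloping_ind (S := fun y => ad_nilpotent (gA u) (jA y)) U_env) y => [||y z yn zn|].
- split=> [|c y z yn zn]; first by rewrite rmorph0; case: nP.
  by rewrite linearP; case: nP => _; apply.
- by rewrite rmorph1; exists 1%N; rewrite /= /ad mulr1 mul1r subrr.
- by rewrite rmorphM; apply: ad_nilpotentM.
move=> t; rewrite -gAE; move: t.
by apply: (lie_ind gA_bracket nP) => // y z; apply: ad_nilpotent_ad.
Qed.

Lemma real_root_simple i : real_root a (simple_root i).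
Proof. by exists [::], i. Qed.

Lemma real_root_opp_simple i : real_root a (- simple_root i).
Proof.
exists [:: i], i; rewrite /= /lattice_refl (bigD1 i)//= big1 => [|j /negPf ji].
  have [a2 _ _] := a_cartan; rewrite {2}/simple_root mxE !eqxx a2 mulr1 addr0.
  by rewrite -[2]/(1 + 1) scalerDl scale1r opprD addrA subrr sub0r.
by rewrite /simple_root mxE eqxx ji mulr0.
Qed.

Lemma root_val_simple i (h : cartan g) : root_val (simple_root i) h = alpha i h.
Proof.
rewrite /root_val (bigD1 i)//= big1 ?addr0 => [|j /negPf ji].
  by rewrite /simple_root mxE !eqxx mul1r.
by rewrite /simple_root mxE eqxx ji mul0r.
Qed.

Lemma weight_gen_e i : weight_space (simple_root i) (gen_e g i).
Proof. by move=> h; rewrite bracket_he root_val_simple. Qed.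

Lemma weight_gen_f i : weight_space (- simple_root i) (gen_f g i).
Proof.
move=> h; rewrite bracket_hf -scaleNr; congr (_ *: _).
rewrite -[sroot g i h : K]root_val_simple /root_val -sumrN; apply: eq_bigr => j _.
by rewrite [(- simple_root i) _ _]mxE rmorphN mulNr.
Qed.

Lemma ad_e_nilpotent i x : ad_nilpotent (E i) x.
Proof.
apply: (admissible_ad_nilpotent (real_root_simple i) (@weight_gen_e i)).
- move=> h; exists 2%N; rewrite /= [ad (E i) (H h)]adC (ad_HE gA_bracket) linearN linearZ /=.
  by rewrite adxx scaler0 oppr0.
- move=> j; have [->|ij] := eqVneq i j; first by exists 1%N; rewrite /= adxx.
  by exists `|1 - a i j|%N; rewrite (serre_iter_E gA_bracket).
move=> j; have [->|ij] := eqVneq i j; last first.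
  by exists 1%N; rewrite /= (ad_EF gA_bracket) (negPf ij).
exists 3%N; rewrite /= (ad_EF gA_bracket) eqxx [ad (E j) (H _)]adC (ad_HE gA_bracket).
by rewrite linearN linearZ /= adxx scaler0 oppr0.
Qed.

Lemma ad_f_nilpotent i x : ad_nilpotent (F i) x.
Proof.
apply: (admissible_ad_nilpotent (real_root_opp_simple i) (@weight_gen_f i)).
- move=> h; exists 2%N; rewrite /= [ad (F i) (H h)]adC (ad_HF gA_bracket) linearN linearZ /=.
  by rewrite adxx scaler0 oppr0.
- move=> j; have [->|ij] := eqVneq i j; last first.
    by exists 1%N; rewrite /= (ad_F_string0 gA_bracket).
  exists 3%N; rewrite /= [ad (F j) (E j)]adC (ad_EF gA_bracket) eqxx linearN /=.
  rewrite [ad (F j) (H _)]adC (ad_HF gA_bracket) opprK linearZ /=.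
  by rewrite adxx scaler0.
move=> j; have [->|ij] := eqVneq i j; first by exists 1%N; rewrite /= adxx.
by exists `|1 - a i j|%N; rewrite (serre_iter_F gA_bracket).
Qed.

(** Integrality is required on the simple coroots as an eigenvalue equation,
so that it is meaningful, and additive in [h], also for [x = 0]. *)
Definition integral_weight x :=
  (forall h, exists c, ad (H h) x = c *: x) /\
  (forall i, exists m : int, ad (H (coroot g i)) x = m%:~R *: x).

Lemma ad_gA_linear x c h h' :
  ad (H (c *: h + h')) x = c *: ad (H h) x + ad (H h') x.
Proof.
rewrite !linearP /ad mulrDl mulrDr -scalerAl -scalerAr.
by rewrite opprD addrACA -scalerBr.
Qed.

Lemma integral_weight_lattice x h : integral_weight x -> coroot_lattice h ->
  exists m : int, ad (H h) x = m%:~R *: x.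
Proof.
move=> [_ xm] [c ->]; elim: (index_enum _) => [|i s [m IH]].
  by exists 0; rewrite big_nil !linear0 /ad mul0r mulr0 subr0 scale0r.
have [m' xm'] := xm i; exists (c i * m' + m).
by rewrite big_cons ad_gA_linear xm' IH scalerA -scalerDl rmorphD rmorphM.
Qed.

Lemma integral_weight_ad x y : integral_weight x -> integral_weight y ->
  integral_weight (ad x y).
Proof.
move=> [xh xi] [yh yi]; split=> [h|i].
  have [k xk] := xh h; have [l yl] := yh h; exists (k + l); exact: eigen_ad.
have [k xk] := xi i; have [l yl] := yi i; exists (k + l).
by rewrite rmorphD; exact: eigen_ad.
Qed.

Lemma integral_weight_h h : integral_weight (H h).
Proof.
by split=> [h'|i]; exists 0; rewrite (ad_HH gA_bracket) scale0r.
Qed.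

Lemma integral_weight_e j : integral_weight (E j).
Proof.
split=> [h|i]; first by exists (alpha j h); rewrite (ad_HE gA_bracket).
by exists (a i j); rewrite (ad_HE gA_bracket) alpha_coroot.
Qed.

Lemma integral_weight_f j : integral_weight (F j).
Proof.
split=> [h|i]; first by exists (- alpha j h); rewrite (ad_HF gA_bracket).
by exists (- a i j); rewrite (ad_HF gA_bracket) alpha_coroot rmorphN.
Qed.

Lemma weight_vector_integral x mu : (forall h, ad (H h) x = mu h *: x) -> integral_weight x.
Proof.
move=> xmu; have [->|x0] := eqVneq x 0.
  by split=> [h|i]; exists 0; rewrite linear0 scaler0.
split=> [h|i]; first by exists (mu h).
have [a2 _ _] := a_cartan.
have [m mE] : exists m : int, mu (coroot g i) = m%:~R.
  apply: (sl2_integral (e := ad (E i)) (f := ad (F i)) (h := ad (H (coroot g i)))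
    _ _ _ _ _ x0 (xmu _)).
  - by move=> y /=; rewrite ad_ad (ad_EF gA_bracket) eqxx addrC.
  - move=> y /=; rewrite ad_ad (ad_HE gA_bracket) alpha_coroot a2 addrC; congr (_ + _).
    by rewrite adZl scaler_int.
  - move=> y /=; rewrite ad_ad (ad_HF gA_bracket) alpha_coroot a2 addrC; congr (_ + _).
    by rewrite adZl scaleNr scaler_int.
  - exact: ad_e_nilpotent.
  - exact: ad_f_nilpotent.
by exists m; rewrite xmu mE.
Qed.

End Admissible.

(** * Weight vectors and the localization *)

Section Localization.
Variables (K : numFieldType) (r : nat) (a : 'M[int]_r) (d : 'I_r -> nat) (g : kacMoody K a).
Variables (U A A' : algType K) (iU : {linear g -> U}) (jA : {lrmorphism U -> A}).
Variables (Uh : comAlgType K) (iUh : {linear cartan g -> Uh}) (jU : {lrmorphism Uh -> U}).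
Variables (D : comUnitAlgType K) (lD : {lrmorphism Uh -> D}).
Variables (lA : {lrmorphism A -> A'}) (dA : {lrmorphism D -> A'}).
Variable gA : {linear g -> A}.
Local Notation H h := (gA (cartan_in g h)).
Local Notation kap h := (lD (iUh h)).
Hypothesis a_cartan : generalized_cartan a.
Hypothesis a_sym : symmetrizes a d.
Hypothesis gAE : forall u, gA u = jA (iU u).
Hypothesis U_env : is_enveloping (@bracket _ g) iU.
Hypothesis Uh_env : is_enveloping (fun _ _ => 0) iUh.
Hypothesis jU_cartan : forall h, jU (iUh h) = iU (cartan_in g h).
Hypothesis D_loc : is_localization (localization_set d iUh) lD.
Hypothesis A_adm : admissible iU jA.
Hypothesis dA_lD : forall u, dA (lD u) = lA (jA (jU u)).
Hypothesis A'_tensor : is_balanced_tensor (fun (c : D) (u : Uh) => c * lD u)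
    (fun (u : Uh) (x : A) => jA (jU u) * x) (fun c x => dA c * lA x).

Lemma dA_cartan h : dA (kap h) = lA (H h).
Proof. by rewrite dA_lD jU_cartan gAE. Qed.

Lemma kap_root_unit n (k : int) : is_root g n ->
  kap (h_root g d n) + k%:~R \is a GRing.unit.
Proof.
move=> n_root; have [lU _ _] := D_loc.
have -> : kap (h_root g d n) + k%:~R = lD (iUh (h_root g d n) + k%:~R).
  by rewrite rmorphD rmorph_int.
apply: lU; exists [:: iUh (h_root g d n) + k%:~R] => [y|]; last by rewrite big_seq1.
by rewrite inE => /eqP->; exists n, k.
Qed.

(** [e_i] is nonzero because its bracket with [f_i] is the coroot, on which
[alpha_i] takes the value 2. *)
Lemma simple_root_is_root i : is_root g (simple_root i).
Proof.
split.
  apply/eqP => /rowP /(_ i) /eqP; rewrite /simple_root !mxE !eqxx.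
  by rewrite oner_eq0.
exists (gen_e g i); last exact: weight_gen_e.
apply/eqP => e0; have := bracket_ef g i i; rewrite e0 eqxx.
have [brl _] := bracket_bilinear g.
have := brl (-1) 0 0 (gen_f g i); rewrite scaler0 addr0 scaleN1r addNr => -> /esym h0.
have : coroot g i = 0 by apply: (@cartan_in_inj _ _ _ g); rewrite h0 linear0.
move=> c0; have [a2 _ _] := a_cartan; have := alpha_coroot g i i.
by rewrite c0 linear0 a2 => /esym/eqP; rewrite intr_eq0.
Qed.

Lemma kap_coroot_unit i (k : int) : kap (coroot g i) + k%:~R \is a GRing.unit.
Proof.
by rewrite -(h_root_simple g a_cartan a_sym); apply/kap_root_unit/simple_root_is_root.
Qed.

(** The relation to keep in mind is [c x = x c'] for a weight vector [x], or
its converse. It suffices to treat the numerators, generated by the Cartan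
subalgebra, and the denominators [h_gamma + k], which are matched with
[h_gamma + k + m], again a denominator. *)
Lemma localization_total (R : D -> D -> Prop) :
  R 1 1 ->
  (forall (k : K) c c' e e', R c c' -> R e e' -> R (k *: c + e) (k *: c' + e')) ->
  (forall c c' e e', R c c' -> R e e' -> R (c * e) (c' * e')) ->
  (forall c c', c \is a GRing.unit -> c' \is a GRing.unit -> R c c' -> R c^-1 c'^-1) ->
  (forall h, exists c : K, R (kap h) (kap h + c%:A)) ->
  (forall h, coroot_lattice h -> exists m : int, R (kap h) (kap h + m%:~R)) ->
  forall c, exists c', R c c'.
Proof.
move=> R1 RD RM RV Rh Rl c.
have R0 : R 0 0 by have := RD (-1) _ _ _ _ R1 R1; rewrite scaleN1r addNr.
have RU u : exists c', R (lD u) c'.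
  apply: (enveloping_ind (S := fun u => exists c', R (lD u) c') Uh_env) u.
  - split=> [|k u v [c1 uc] [c2 vc]]; first by exists 0; rewrite rmorph0.
    by exists (k *: c1 + c2); rewrite linearP; apply: RD.
  - by exists 1; rewrite rmorph1.
  - by move=> u v [c1 uc] [c2 vc]; exists (c1 * c2); rewrite rmorphM; apply: RM.
  by move=> h; have [k hk] := Rh h; exists (kap h + k%:A).
have [lU fracD _] := D_loc; have [u [s [Gs ->]]] := fracD c.
suff [s' s'U Rs] : exists2 s', s' \is a GRing.unit & R (lD s) s'.
  have [c' Ru] := RU u; exists (c' / s'); apply: RM => //.
  by apply: RV => //; apply: lU.
case: Gs => t; elim: t s => [|y t IH] s Gt ->.
  by exists 1; rewrite ?unitr1// big_nil rmorph1.
have [n [k [n_root yE]]] := Gt y (mem_head _ _).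
have [|s' s'U Rs] := IH _ _ erefl; first by move=> z zt; apply: Gt; rewrite in_cons zt orbT.
have [m Rm] := Rl _ (h_root_lattice g a_cartan a_sym n).
exists ((kap (h_root g d n) + (k + m)%:~R) * s').
  by rewrite unitrMl// kap_root_unit.
rewrite big_cons rmorphM; apply: RM => //; rewrite yE rmorphD rmorph_int.
have := RD k%:~R _ _ _ _ R1 Rm; rewrite scaler_int addrC.
by rewrite [X in R _ X]addrC -addrA -rmorphD [(m + k)%R]addrC.
Qed.

Section Commute.
Variable x : A.
Hypothesis xw : integral_weight gA x.
Let R c c' := dA c * lA x = lA x * dA c'.

Let R1 : R 1 1.
Proof. by rewrite /R !rmorph1 mulr1 mul1r. Qed.

Let RD (k : K) c c' e e' : R c c' -> R e e' -> R (k *: c + e) (k *: c' + e').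
Proof.
by rewrite /R !linearP /= mulrDl mulrDr -scalerAl -scalerAr => -> ->.
Qed.

Let RM c c' e e' : R c c' -> R e e' -> R (c * e) (c' * e').
Proof. by rewrite /R => cE eE; rewrite !rmorphM -mulrA eE mulrA cE mulrA. Qed.

Let RV c c' : c \is a GRing.unit -> c' \is a GRing.unit -> R c c' -> R c^-1 c'^-1.
Proof.
rewrite /R => cU c'U cE; rewrite -[LHS]mulr1 -(rmorph1 dA) -(mulrV c'U) rmorphM.
rewrite mulrA -[_ * lA x * _]mulrA -cE !mulrA -rmorphM mulVr//.
by rewrite rmorph1 mul1r.
Qed.

Let Rh h c : ad (H h) x = c *: x -> R (kap h) (kap h + c%:A).
Proof.
move=> xc; rewrite /R dA_cartan -rmorphM /= adE xc addrC.
have -> : dA (kap h + c%:A) = lA (H h) + c%:A.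
  by rewrite rmorphD -dA_cartan; congr (_ + _); exact: rmorph_alg.
by rewrite linearP /= rmorphM mulrDr -scalerAr mulr1 addrC.
Qed.

Let RhN h c : R (kap h) (kap h + c%:A) -> R (kap h + (- c)%:A) (kap h).
Proof.
move=> Rc; have := RD (- c) R1 Rc; rewrite addrC => Rc'.
by move: Rc'; rewrite addrC [X in R _ X]addrC scaleNr addrK addrC.
Qed.

Let int_scalar (m : int) : (m%:~R : K)%:A = m%:~R :> D.
Proof. by rewrite scaler_int. Qed.

Lemma integral_weight_left c : exists c', dA c * lA x = lA x * dA c'.
Proof.
apply: (localization_total R1 RD RM RV).
- by move=> h; have [k xk] := xw.1 h; exists k; apply: Rh.
- move=> h hl; have [m xm] := integral_weight_lattice xw hl.
  by exists m; rewrite -int_scalar; apply: Rh.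
Qed.

Lemma integral_weight_right c : exists c', lA x * dA c = dA c' * lA x.
Proof.
suff [c' RE] : exists c', R c' c by exists c'.
apply: (localization_total (R := fun c c' => R c' c)) => //.
- by move=> k c1 c1' c2 c2'; apply: RD.
- by move=> c1 c1' c2 c2'; apply: RM.
- by move=> c1 c1' U1 U2; apply: RV.
- by move=> h; have [k xk] := xw.1 h; exists (- k); apply/RhN/Rh.
- move=> h hl; have [m xm] := integral_weight_lattice xw hl.
  exists (- m); rewrite -int_scalar rmorphN; apply/RhN/Rh; exact: xm.
Qed.

End Commute.

(** [A'] is defined as the span of the [d x]; to write it as the span of the
[x d], note that the [x] with [D x] inside that span form a subalgebra of
[A], which contains all integral weight vectors. *)
Lemma localized_ind (P : A' -> Prop) : (forall y z, P y -> P z -> P (y + z)) ->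
  (forall x c, P (lA x * dA c)) -> forall y, P y.
Proof.
pose AD_span y := forall P : A' -> Prop, (forall y z, P y -> P z -> P (y + z)) ->
  (forall x c, P (lA x * dA c)) -> P y.
suff all_rspan y : AD_span y by move=> PD PM y; apply: all_rspan.
have rspanD y1 y2 : AD_span y1 -> AD_span y2 -> AD_span (y1 + y2).
  by move=> s1 s2 Q QD QM; apply: (QD); [apply: s1|apply: s2].
have rspanM x c : AD_span (lA x * dA c) by move=> Q _; apply.
have rspan0 : AD_span 0 by have := rspanM 0 0; rewrite rmorph0 mul0r.
have rspanl x y1 : AD_span y1 -> AD_span (lA x * y1).
  move=> s1; apply: (s1 (fun y => AD_span (lA x * y))) => [y2 y3 s2 s3|x' c].
    by rewrite mulrDr; apply: (rspanD).
  by rewrite mulrA -rmorphM; apply: (rspanM).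
pose good x := forall c, AD_span (dA c * lA x).
have goodP : submod_set good.
  split=> [c|k x x' gx gx' c]; first by rewrite rmorph0 mulr0.
  rewrite linearP mulrDr; apply: (rspanD); last exact: gx'.
  by rewrite /= -scalerAr scalerAl -linearZ; apply: gx.
have good1 : good 1.
  by move=> c; rewrite rmorph1 mulr1 -[dA c]mul1r -(rmorph1 lA); apply: (rspanM).
have goodM x x' : good x -> good x' -> good (x * x').
  move=> gx gx' c; rewrite rmorphM mulrA.
  apply: (gx c (fun y => AD_span (y * lA x'))) => [y1 y2 s1 s2|x1 c1].
    by rewrite mulrDl; apply: (rspanD).
  by rewrite -mulrA; apply: (rspanl); apply: (gx').
have goodW x : integral_weight gA x -> good x.
  by move=> xw c; have [c' ->] := integral_weight_left xw c; apply: (rspanM).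
have goodA x : good x.
  have [_ [V [v [_ [_ [UV _] _ Vss]]]]] := A_adm.
  apply: (tensor_ind UV) x => // u w; apply: (goodM).
    apply: (enveloping_ind (S := fun u => good (jA u)) U_env) u.
    - split=> [|k u1 u2 g1 g2]; first by rewrite rmorph0; case: goodP.
      by rewrite linearP; case: goodP => _; apply.
    - by rewrite rmorph1.
    - by move=> u1 u2 g1 g2; rewrite rmorphM; apply: (goodM).
    move=> t; rewrite -gAE; move: t; apply: (lie_ind (gA_bracket U_env gAE) goodP).
    - move=> y1 y2 g1 g2; apply: (@submodD _ _ good) => //; first exact: goodM.
      by apply: (@submodN _ _ good) => //; apply: (goodM).
    - by move=> h; apply: (goodW); exact: (integral_weight_h U_env gAE).
    - by move=> j; apply: (goodW); exact: (integral_weight_e U_env gAE).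
    - by move=> j; apply: (goodW); exact: (integral_weight_f U_env gAE).
  have [s -> sw] := Vss w; rewrite linear_sum big_seq.
  elim/big_rec: _ => [|w' z w's gz]; first by case: goodP.
  apply: (@submodD _ _ good) => //; apply: (goodW); have [mu muE] := sw w' w's.
  by apply: (weight_vector_integral a_cartan U_env A_adm gAE (mu := mu)) => h; rewrite gAE.
apply: (balanced_tensor_ind A'_tensor) y => [|c x]; last exact: goodA.
split=> // k y1 y2 s1 s2; apply: (rspanD) => //.
apply: (s1 (fun y => AD_span (k *: y))) => [y3 y4 s3 s4|x c].
  by rewrite scalerDr; apply: (rspanD).
by rewrite scalerAr -linearZ; apply: (rspanM).
Qed.

End Localization.

(** * The calculus of the Zhelobenko operator *)

Section ZhelobenkoOperators.
Variables (K : numFieldType) (A A' : algType K) (D : comUnitAlgType K).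
Variables (M : lmodType A') (lA : {lrmorphism A -> A'}) (dA : {lrmorphism D -> A'}).
Variables (eA fA hA : A) (hD : D) (v0 : M) (rho : D -> M -> M).
Variables (tau : D -> D) (q : A' -> M).
Local Notation e := (lA eA).
Local Notation f := (lA fA).

(** [f^n] times the inverse of [h (h - 1) ... (h - n + 1)], so that
[verma_coef n *: v0] is the vector [v_n] of the introduction. *)
Definition verma_coef n : A' := f ^+ n * dA (\prod_(k < n) (hD - k%:R))^-1.
Local Notation w := verma_coef.
Local Notation v n := (w n *: v0).

(** [M] is a left [A']-module with a commuting right action [rho] of [D],
[v0] is a highest weight vector for the sl2-triple, and [q] is the Zhelobenko
operator with values in [M]. *)
Record zhelobenko_setting : Prop := ZhelobenkoSetting {
  zs_ef : ad eA fA = hA;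
  zs_he : ad hA eA = eA *+ 2;
  zs_hf : ad hA fA = - (fA *+ 2);
  zs_h : dA hD = lA hA;
  zs_unit : forall k : int, hD + k%:~R \is a GRing.unit;
  zs_nilpotent : forall x, exists N, iter N (ad eA) x = 0;
  zs_ind : forall P : A' -> Prop, (forall y z, P y -> P z -> P (y + z)) ->
    (forall x c, P (lA x * dA c)) -> forall y, P y;
  zs_v0 : e *: v0 = 0;
  zs_rho : forall c b x y, rho c (b *: x + y) = b *: rho c x + rho c y;
  zs_rho_v0 : forall c, rho c v0 = dA c *: v0;
  zs_qD : forall y z, q (y + z) = q y + q z;
  zs_qA : forall x N, iter N (ad eA) x = 0 ->
    q (lA x) = \sum_(n < N) (lA (signed_ad eA n x) * w n) *: v0;
  zs_qr : forall y c, q (y * dA c) = rho (tau c) (q y) }.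

Hypothesis setting : zhelobenko_setting.

Let ad_ef := zs_ef setting.
Let ad_he := zs_he setting.
Let ad_hf := zs_hf setting.
Let hDA := zs_h setting.
Let hD_unit := zs_unit setting.
Let e_v0 := zs_v0 setting.
Let rho_linear := zs_rho setting.
Let rho_v0 := zs_rho_v0 setting.
Let ad_nil := zs_nilpotent setting.
Let A'_ind := zs_ind setting.
Let qD := zs_qD setting.
Let q_right := zs_qr setting.
Let qA := zs_qA setting.

Let hD_unitN k : hD - k%:R \is a GRing.unit.
Proof. by have := hD_unit (- k%:Z); rewrite rmorphN. Qed.

Let hD_unitP k : hD + k%:R \is a GRing.unit.
Proof. exact: (hD_unit k%:Z). Qed.

Let rho0 c : rho c 0 = 0.
Proof. by have := rho_linear c (-1) 0 0; rewrite scaler0 addr0 scaleN1r addNr. Qed.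

Let rhoZ c a x : rho c (a *: x) = a *: rho c x.
Proof. by rewrite -[a *: x]addr0 rho_linear rho0 !addr0. Qed.

Let rhoB c x y : rho c (x - y) = rho c x - rho c y.
Proof. by rewrite addrC -scaleN1r rho_linear scaleN1r addrC. Qed.

Let rhoDr c x y : rho c (x + y) = rho c x + rho c y.
Proof. by rewrite -[x]scale1r rho_linear !scale1r. Qed.

Let rho_sum c (I : finType) (F : I -> M) : rho c (\sum_i F i) = \sum_i rho c (F i).
Proof. exact: (big_morph (rho c) (rhoDr c) (rho0 c)). Qed.

Lemma cartan_lowering_exp n c : dA (hD + c%:R) * f ^+ n = f ^+ n * dA (hD + c%:R - (n.*2)%:R).
Proof.
have hf : dA hD * f = f * dA (hD - 2).
  rewrite hDA -rmorphM /= adE ad_hf rmorphD rmorphM rmorphN /= -hDA.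
  by rewrite rmorphB rmorph_nat mulrBr mulr_natr rmorphMn.
elim: n => [|n IH]; first by rewrite expr0 mul1r mulr1 subr0.
rewrite exprSr mulrA IH -mulrA -[in RHS]mulrA; congr (_ * _).
transitivity (dA hD * f + (c%:R - n.*2%:R) * f).
  by rewrite -addrA rmorphD mulrDl rmorphB !rmorph_nat.
rewrite hf [_ * f](_ : _ = f * dA (c%:R - n.*2%:R)).
  rewrite -mulrDr -rmorphD; congr (_ * dA _).
  by rewrite doubleS -addn2 natrD; ring.
by rewrite rmorphB !rmorph_nat mulrBl mulrBr !mulr_natr !mulr_natl.
Qed.

Lemma raising_lowering_exp n :
  e * f ^+ n.+1 = f ^+ n.+1 * e + f ^+ n * dA (n.+1%:R * (hD - n%:R)).
Proof.
have ef : e * f = f * e + dA hD by rewrite -!rmorphM /= adE ad_ef rmorphD hDA.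
elim: n => [|n IH]; first by rewrite !expr1 ef mul1r subr0 mul1r.
rewrite exprSr mulrA IH mulrDl -mulrA ef mulrDr mulrA -exprSr -addrA; congr (_ + _).
have hf m k : dA (m%:R * (hD - k%:R)) * f = f * dA (m%:R * (hD - k%:R - 2)).
  have := cartan_lowering_exp 1 0; rewrite addr0 expr1 => hf.
  rewrite !(rmorphM, rmorph_nat) /= !mulr_natl mulrnAl mulrnAr; congr (_ *+ _).
  rewrite addrAC !(rmorphB _ _ k%:R) /= !rmorph_nat mulrBl hf mulrBr.
  by rewrite mulr_natl mulr_natr.
rewrite -mulrA hf mulrA -exprSr -mulrDr -rmorphD; congr (_ * dA _).
by rewrite -[n.+2%:R]natr1 -[n.+1%:R]natr1; ring.
Qed.

(** Multiplying [f^(n+1)] by [h + n + 2] on the left is multiplying it by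
[h - n] on the right, which cancels the last denominator. *)
Lemma verma_coefS n : dA (hD + n.+2%:R) * w n.+1 = f * w n.
Proof.
rewrite /w mulrA cartan_lowering_exp -mulrA -rmorphM exprS -!mulrA; congr (_ * (_ * dA _)).
rewrite big_ord_recr /= invrM ?rpred_prod//.
rewrite (_ : hD + _ - _ = hD - n%:R) ?mulVKr//.
by rewrite -addnn -[n.+2%:R]natr1 natrD -!natr1; ring.
Qed.

Lemma raising_verma n : e *: v n = v n.-1 *+ n.
Proof.
have e0 c : (e * dA c) *: v0 = 0 by rewrite -scalerA -rho_v0 -rhoZ e_v0 rho0.
case: n => [|n]; rewrite /w scalerA mulrA.
  by rewrite expr0 mulr1 e0.
rewrite raising_lowering_exp mulrDl -mulrA scalerDl -scalerA e0 scaler0 add0r -mulrA -rmorphM.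
rewrite -scaler_nat scalerA; congr (_ *: _).
rewrite [RHS]mulr_natl -mulrnAr -rmorphMn -[in RHS]mulr_natl; congr (_ * dA _).
by rewrite big_ord_recr /= invrM ?rpred_prod// -mulrA mulVKr.
Qed.

Definition zorder x := projT1 (cid (ad_nil x)).

(** The shifted series [F_k(x) = \sum_m x_m v_(m+k)]. *)
Definition zseries k x : M := \sum_(m < zorder x) lA (signed_ad eA m x) *: v (m + k).
Local Notation F := zseries.

Lemma signed_ad_zorder x n : (zorder x <= n)%N -> signed_ad eA n x = 0.
Proof. by apply: signed_ad_eq0; rewrite /zorder; case: cid. Qed.

Lemma zseriesE k x N : (forall n, (N <= n)%N -> signed_ad eA n x = 0) ->
  F k x = \sum_(m < N) lA (signed_ad eA m x) *: v (m + k).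
Proof.
move=> xN; pose G m := lA (signed_ad eA m x) *: v (m + k).
have [le|/ltnW le] := leqP (zorder x) N; [apply: esym|];
  apply: (sum_ord_trunc (F := G) le) => n.
  by move/signed_ad_zorder => x0; rewrite /G x0 rmorph0 scale0r.
by move/xN => x0; rewrite /G x0 rmorph0 scale0r.
Qed.

Lemma q_zseries x : q (lA x) = F 0 x.
Proof.
rewrite (qA (N := zorder x)); last by rewrite /zorder; case: cid.
by apply: eq_bigr => m _; rewrite addn0 scalerA.
Qed.

Lemma zseriesM k x y N : (forall n, (N <= n)%N -> signed_ad eA n x = 0) ->
  F k (x * y) = \sum_(j < N) lA (signed_ad eA j x) *: F (k + j) y.
Proof.
move=> xN; pose G j m : M := (lA (signed_ad eA j x) * lA (signed_ad eA m y)) *: v (m + (k + j)).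
rewrite (@zseriesE k _ (N + zorder y)) => [|n leNn]; last first.
  rewrite signed_adM big1// => j _; have [/xN->|ltjN] := leqP N j; first by rewrite mul0r.
  have jn : (j <= n)%N by rewrite -ltnS.
  rewrite (@signed_ad_zorder y (n - j)) ?mulr0// -(leq_add2l j) subnKC//.
  by apply: leq_trans leNn; rewrite leq_add2r ltnW.
transitivity (\sum_(j < N) \sum_(m < zorder y) G j m); last first.
  by apply: eq_bigr => j _; rewrite scaler_sumr; apply: eq_bigr => m _; rewrite scalerA.
rewrite -sum_triangle_trunc => [|j m Nj|j m Nm]; last 2 first.
- by rewrite /G xN// rmorph0 mul0r scale0r.
- by rewrite /G [signed_ad eA m y]signed_ad_zorder// rmorph0 mulr0 scale0r.
apply: eq_bigr => n _; rewrite signed_adM rmorph_sum scaler_suml; apply: eq_bigr => j _.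
have jn : (j <= n)%N by rewrite -ltnS.
by rewrite /G rmorphM addnCA subnK// [(k + n)%N]addnC.
Qed.

(** Moving [e] past [x_m] produces [- (m + 1) x_(m+1)]; after reindexing these
terms cancel a part [m] of the coefficient [m + k + 1] coming from
[e v_(m+k+1)]. *)
Lemma raising_zseries k y : e *: F k.+1 y = F k y *+ k.+1.
Proof.
rewrite /F scaler_sumr -sumrMnl /=.
pose N := zorder y; pose G m := (lA (signed_ad eA m y) *: v (m + k)) *+ m.
transitivity (\sum_(m < N) ((lA (signed_ad eA m y) *: v (m + k)) *+ (m + k.+1) - G m.+1)).
  apply: eq_bigr => m _.
  rewrite scalerA -rmorphM adE rmorphD rmorphM scalerDl -scalerA.
  rewrite raising_verma addnS /= -scalerMnr; congr (_ + _).
  rewrite -[X in lA X]opprK -signed_adS rmorphN scaleNr; congr (- _).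
  by rewrite scaler_nat rmorphMn /= /G addSn -scalerMnl.
(* [G 0 = 0] and [G N = 0], so the shifted sum is unchanged. *)
rewrite sumrB; have -> : \sum_(m < N) G m.+1 = \sum_(m < N) G m.
  transitivity (\sum_(m < N.+1) G m); first by rewrite big_ord_recl /G mulr0n add0r.
  by rewrite big_ord_recr /= /G signed_ad_zorder// rmorph0 scale0r mul0rn addr0.
by rewrite -sumrB; apply: eq_bigr => m _; rewrite /G mulrnDr addrAC subrr add0r.
Qed.

Lemma raising_zseries0 y : e *: F 0 y = 0.
Proof.
rewrite /F scaler_sumr /=.
pose N := zorder y; pose G m := (lA (signed_ad eA m y) *: v m.-1) *+ m.
transitivity (\sum_(m < N) (G m - G m.+1)).
  apply: eq_bigr => m _.
  rewrite scalerA -rmorphM adE rmorphD rmorphM scalerDl -scalerA.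
  rewrite raising_verma addn0 /= -scalerMnr; congr (_ + _).
  rewrite -[X in lA X]opprK -signed_adS rmorphN scaleNr; congr (- _).
  by rewrite scaler_nat rmorphMn /= /G -scalerMnl.
apply: oppr_inj; rewrite oppr0 -sumrN -(big_mkord xpredT (fun m => - (G m - G m.+1))).
under eq_bigr do rewrite opprB.
by rewrite telescope_sumr// /G signed_ad_zorder// rmorph0 scale0r mul0rn subr0.
Qed.

(** The product formula for [x = f], whose coefficients are [f], [- h],
[- e], 0, ... *)
Lemma zseries_lowering k y : F k (fA * y) = f *: F k y - dA (hD + k.+2%:R) *: F k.+1 y.
Proof.
have fA2 : signed_ad eA 2 fA = - eA.
  have two : 2%:R != 0 :> K by rewrite pnatr_eq0.
  apply: (scalerI two); rewrite signed_adS signed_ad1 ad_ef linearN opprK /= adC ad_he.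
  by rewrite scalerN scaler_nat.
have fA3 n : (3 <= n)%N -> signed_ad eA n fA = 0.
  move=> n3; apply: signed_ad_eq0 n3 => /=.
  by rewrite ad_ef [ad eA hA]adC ad_he linearN linearMn /= adxx mul0rn oppr0.
rewrite (zseriesM k y fA3) !big_ord_recr big_ord0 /= add0r.
rewrite signed_ad0 signed_ad1 fA2 ad_ef addn0 addn1 addn2 !rmorphN !scaleNr.
have -> : dA (hD + k.+2%:R) = lA hA + k.+2%:R.
  by rewrite -hDA -[in RHS](rmorph_nat dA) -rmorphD.
by rewrite raising_zseries -scaler_nat (scalerDl _ (lA hA) k.+2%:R) opprD addrA.
Qed.

(** The maps [Q_k] extending the series [F_k] to [A']. They are defined from
[q] by solving [zseries_lowering] for the next series: a direct formula on
[A'] would have to be shown independent of the way an element is written as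
a sum of products [x d]. *)
Fixpoint zhigher k (y : A') : M :=
  if k is k'.+1 then
    dA (hD + k'.+2%:R)^-1 *: (f *: zhigher k' y - zhigher k' (f * y))
  else q y.
Local Notation Q := zhigher.

Let Kunit c (x : M) : c \is a GRing.unit -> dA c^-1 *: (dA c *: x) = x.
Proof. by move=> cU; rewrite scalerA -rmorphM mulVr// rmorph1 scale1r. Qed.

Lemma zhigherS k y :
  Q k.+1 y = dA (hD + k.+2%:R)^-1 *: (f *: Q k y - Q k (f * y)).
Proof. by []. Qed.

Arguments zhigher : simpl never.

Lemma zhigherD k : {morph Q k : y z / y + z}.
Proof.
elim: k => [|k IH] y z; first exact: qD.
by rewrite !zhigherS mulrDr !IH [f *: _]scalerDr opprD addrACA scalerDr.
Qed.

Lemma zhigher_right k y c : Q k (y * dA c) = rho (tau c) (Q k y).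
Proof.
elim: k y => [|k IH] y; first exact: q_right.
by rewrite !zhigherS mulrA !IH rhoZ rhoB rhoZ.
Qed.

Lemma zhigher_zseries k y : Q k (lA y) = F k y.
Proof.
elim: k y => [|k IH] y; first exact: q_zseries.
by rewrite zhigherS -rmorphM !IH zseries_lowering subKr Kunit.
Qed.

Lemma zhigherM k x y N : iter N (ad eA) x = 0 ->
  Q k (lA x * y) = \sum_(j < N) lA (signed_ad eA j x) *: Q (k + j) y.
Proof.
move=> xN; elim/A'_ind: y => [y z IHy IHz|y c].
  rewrite mulrDr zhigherD IHy IHz -big_split; apply: eq_bigr => j _.
  by rewrite zhigherD scalerDr.
rewrite mulrA -rmorphM zhigher_right zhigher_zseries.
rewrite (@zseriesM _ _ _ N) => [|n]; last exact: signed_ad_eq0.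
rewrite rho_sum; apply: eq_bigr => j _.
by rewrite rhoZ zhigher_right zhigher_zseries.
Qed.

Lemma raising_q y : e *: q y = 0.
Proof.
elim/A'_ind: y => [y z IHy IHz|y c]; first by rewrite qD scalerDr IHy IHz addr0.
by rewrite q_right q_zseries -rhoZ raising_zseries0 rho0.
Qed.

Lemma raising_zhigher1 y : e *: Q 1 y = q y.
Proof.
elim/A'_ind: y => [y z IHy IHz|y c]; first by rewrite zhigherD scalerDr IHy IHz qD.
by rewrite q_right zhigher_right zhigher_zseries -rhoZ raising_zseries q_zseries.
Qed.

(** The coefficients of [t] are [t], [a e] and 0, ..., and [e] undoes the
shift of the series. *)
Lemma q_weight_left t a y : ad t eA = a *: eA -> q (lA t * y) = (lA t + a%:A) *: q y.
Proof.
move=> tw; have et : ad eA t = - (a *: eA) by rewrite adC tw.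
have t2 : iter 2 (ad eA) t = 0 by rewrite /= et linearN linearZ /= adxx scaler0 oppr0.
rewrite -[LHS]/(Q 0 _) (@zhigherM 0 t y 2 t2) !big_ord_recr big_ord0 /= !add0r.
rewrite signed_ad0 signed_ad1 et opprK.
rewrite scalerDl; congr (_ + _).
by rewrite linearZ /= -[a *: e]mulr_algl -scalerA raising_zhigher1.
Qed.

Section Annihilated.
Variable Z : A -> Prop.
Hypothesis Z_ad_e : forall z, Z z -> Z (ad eA z).
Hypothesis Z_ad_f : forall z, Z z -> Z (ad fA z).
Hypothesis Z_v0 : forall z, Z z -> lA z *: v0 = 0.

Lemma annihilated_verma n z : Z z -> lA z *: v n = 0.
Proof.
move=> Zz; rewrite /w -scalerA -rho_v0; move: (_^-1) => c.
elim: n z Zz => [|n IH] z Zz; first by rewrite expr0 scale1r -rhoZ Z_v0.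
rewrite exprS -scalerA scalerA -rmorphM adE adC rmorphB rmorphM scalerBl.
by rewrite -scalerA IH// scaler0 IH ?subr0//; apply: Z_ad_f.
Qed.

Lemma zseries_annihilated k z : Z z -> F k z = 0.
Proof.
move=> Zz; apply: big1 => m _; rewrite /signed_ad linearZ /= -mulr_algl -scalerA.
suff Zm : Z (iter m (ad eA) z) by rewrite annihilated_verma ?scaler0.
by elim: {+}(nat_of_ord m) => //= n; apply: Z_ad_e.
Qed.

(** [Z] is stable under [ad f] and annihilates [v_0], so it annihilates all the
[v_n]; by stability under [ad e] the whole series of an element of [Z]
vanishes. *)
Lemma q_annihilated y z : Z z -> (forall c, exists c', dA c * lA z = lA z * dA c') ->
  q (y * lA z) = 0.
Proof.
move=> Zz zc; elim/A'_ind: y => [y y' IHy IHy'|y c].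
  by rewrite mulrDl qD IHy IHy' addr0.
have [c' cz] := zc c; rewrite -mulrA cz mulrA -rmorphM q_right q_zseries.
rewrite (@zseriesM _ _ _ (zorder y)) => [|n]; last exact: signed_ad_zorder.
by rewrite big1 ?rho0// => j _; rewrite zseries_annihilated ?scaler0.
Qed.

(** In the product formula for [Q_k (z y) = 0] all terms but [z Q_k(y)]
involve [(ad e)^j z] with [j > 0]; conclude by induction on the order of
nilpotence of [z]. *)
Lemma annihilated_q y : (forall k z, Z z -> Q k (lA z * y) = 0) ->
  forall z, Z z -> lA z *: q y = 0.
Proof.
move=> Qy z Zz; have [N zN] := ad_nil z.
have Z_iter m x : Z x -> Z (iter m (ad eA) x).
  by move=> Zx; elim: m => //= m; apply: Z_ad_e.
suff H k : lA z *: Q k y = 0 by apply: (H 0).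
elim: N z Zz zN k => [|N IH] z Zz zN k; first by rewrite /= in zN; rewrite zN rmorph0 scale0r.
have := Qy k z Zz; rewrite (zhigherM _ _ zN) big_ord_recl signed_ad0 addn0.
rewrite big1 ?addr0// => j _; rewrite /signed_ad linearZ /= -mulr_algl -scalerA.
rewrite [X in _ *: X](_ : _ = 0) ?scaler0//; apply: IH; first exact: (Z_iter j.+1).
by rewrite -(iterD N j.+1) (iter_ad_ge zN)// addnS ltnS leq_addr.
Qed.

End Annihilated.

(** [F_k(f) = f v_k - (h + k + 2) v_(k+1) = 0]. *)
Lemma q_lowering y : (forall c, exists c', dA c * f = f * dA c') -> q (y * f) = 0.
Proof.
move=> fc; elim/A'_ind: y => [y y' IHy IHy'|y c].
  by rewrite mulrDl qD IHy IHy' addr0.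
have [c' cz] := fc c; rewrite -mulrA cz mulrA -rmorphM q_right q_zseries.
rewrite (@zseriesM _ _ _ (zorder y)) => [|n]; last exact: signed_ad_zorder.
rewrite big1 ?rho0// => j _; suff -> : F (0 + j) fA = 0 by rewrite scaler0.
have F1 k : F k 1 = v k.
  have ad1 : ad eA 1 = 0 by rewrite /ad mulr1 mul1r subrr.
  rewrite (@zseriesE _ _ 1) => [|n n1]; last exact: (@signed_ad_eq0 _ _ _ 1).
  by rewrite big_ord1 signed_ad0 rmorph1 scale1r.
by rewrite -[fA]mulr1 zseries_lowering !F1 !scalerA verma_coefS subrr.
Qed.

(** The recursion defining [Q_k] loses its second term and becomes the one
satisfied by [verma_coef]. *)
Lemma zhigher_singular y : (forall k, Q k (f * y) = 0) -> forall k, Q k y = w k *: q y.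
Proof.
move=> fy; elim=> [|k IH]; first by rewrite /w big_ord0 invr1 rmorph1 mulr1 scale1r.
by rewrite zhigherS fy subr0 IH [f *: _]scalerA -verma_coefS -scalerA Kunit.
Qed.

(** The same coefficient [X] computes [q(x)] from [v0] and [q(x y)] from
[q(y)]: this is the multiplicativity of [q]. *)
Lemma q_factor x : exists X, q (lA x) = X *: v0 /\
  forall y, (forall k, Q k (f * y) = 0) -> q (lA x * y) = X *: q y.
Proof.
have xN : iter (zorder x) (ad eA) x = 0 by rewrite /zorder; case: cid.
exists (\sum_(n < zorder x) lA (signed_ad eA n x) * w n); split=> [|y fy].
  by rewrite (qA xN) scaler_suml.
rewrite -[LHS]/(Q 0 _) (zhigherM 0 y xN) scaler_suml.
by apply: eq_bigr => j _; rewrite zhigher_singular// scalerA.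
Qed.

End ZhelobenkoOperators.

(** * The operators on the quotient *)

Section RightAction.
Variables (K : fieldType) (B : algType K) (N : B -> Prop).
Implicit Types b c y : B.

Lemma lpiE b : lpi N b = b *: (lpi N 1 : lquot N).
Proof. by rewrite [RHS]lact_lpi mulr1. Qed.

Lemma lpi_linear b c y :
  lpi N (b * c + y) = b *: (lpi N c : lquot N) + lpi N y :> lquot N.
Proof. by rewrite [b *: _]lact_lpi /lpi raddfD. Qed.

Lemma ract_lpi b c : (forall y, y \in left_ideal N -> y * c \in left_ideal N) ->
  ract (lpi N b) c = lpi N (b * c).
Proof.
move=> Nc; apply/lpiP; rewrite -mulrBl; apply: Nc.
by apply/lpiP; rewrite lreprK.
Qed.

Lemma normalizer_quotP (m : lquot N) :
  normalizer_quot m <-> forall z, N z -> z *: m = 0.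
Proof.
split=> [[y yN ->] z Nz|mN].
  by rewrite [LHS]lact_lpi; apply/eqP; rewrite lpi_eq0; apply: yN.
exists (lrepr m); last by rewrite lreprK.
by move=> z Nz; rewrite -lpi_eq0 -lact_lpi lreprK -[lact _ _]/(z *: m) mN.
Qed.

Lemma normalizer_quot_ideal (m : lquot N) b :
  normalizer_quot m -> b \in left_ideal N -> b *: m = 0.
Proof.
move=> /normalizer_quotP mN; elim/left_ideal_ind => [|b1 b2 e1 e2|b1 z Nz].
- by rewrite scale0r.
- by rewrite scalerDl e1 e2 addr0.
by rewrite -scalerA mN// scaler0.
Qed.

Lemma lquot_mulE (m m' : lquot N) : lquot_mul m m' = lrepr m *: m'.
Proof. by rewrite -[in RHS](lreprK m') [RHS]lact_lpi. Qed.

End RightAction.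

Section Assembly.
Variables (K : numFieldType) (r : nat) (a : 'M[int]_r) (d : 'I_r -> nat) (g : kacMoody K a).
Variables (U A A' : algType K) (iU : {linear g -> U}) (jA : {lrmorphism U -> A}).
Variables (Uh : comAlgType K) (iUh : {linear cartan g -> Uh}) (jU : {lrmorphism Uh -> U}).
Variables (D : comUnitAlgType K) (lD : {lrmorphism Uh -> D}).
Variables (tau sdot : 'I_r -> {lrmorphism D -> D}).
Variables (lA : {lrmorphism A -> A'}) (dA : {lrmorphism D -> A'}).
Variables (T : 'I_r -> {lrmorphism U -> U}) (TA : 'I_r -> {lrmorphism A -> A}).
Variables (T' : 'I_r -> {lrmorphism A' -> A'}).
Variable gA : {linear g -> A}.
Local Notation H h := (gA (cartan_in g h)).
Local Notation E j := (gA (gen_e g j)).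
Local Notation F j := (gA (gen_f g j)).
Let kap := lD \o iUh.
Hypothesis a_cartan : generalized_cartan a.
Hypothesis a_sym : symmetrizes a d.
Hypothesis gAE : forall u, gA u = jA (iU u).
Hypothesis U_env : is_enveloping (@bracket _ g) iU.
Hypothesis Uh_env : is_enveloping (fun _ _ => 0) iUh.
Hypothesis jU_cartan : forall h, jU (iUh h) = iU (cartan_in g h).
Hypothesis D_loc : is_localization (localization_set d iUh) lD.
Hypothesis A_adm : admissible iU jA.
Hypothesis dA_lD : forall u, dA (lD u) = lA (jA (jU u)).
Hypothesis A'_tensor : is_balanced_tensor (fun (c : D) (u : Uh) => c * lD u)
    (fun (u : Uh) (x : A) => jA (jU u) * x) (fun c x => dA c * lA x).
Hypothesis tau_kap : forall i h, tau i (kap h) = kap h + (alpha i h)%:A.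
Hypothesis sdot_kap : forall i h,
  sdot i (kap h) = kap (cartan_refl i h) - (alpha i h)%:A.
Hypothesis T_cartan : forall i h, T i (iU (cartan_in g h)) = iU (cartan_in g (cartan_refl i h)).
Hypothesis T_bij : forall i, bijective (T i).
Hypothesis TA_jA : forall i u, TA i (jA u) = jA (T i u).
Hypothesis T'_lA : forall i x, T' i (lA x) = lA (TA i x).

Local Notation nA := (nilA gA lA).
Local Notation nAs i := (nilA_refl gA lA T' i).

Let gA_bracket := gA_bracket U_env gAE.

Let dA_kap h : dA (kap h) = lA (H h).
Proof. exact: (dA_cartan gAE jU_cartan dA_lD). Qed.

Let ind := localized_ind a_cartan a_sym gAE U_env Uh_env jU_cartan D_loc A_adm dA_lD A'_tensor.

Let moveL x := integral_weight_left a_cartan a_sym gAE Uh_env jU_cartan D_loc dA_lD (x := x).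
Let moveR x := integral_weight_right a_cartan a_sym gAE Uh_env jU_cartan D_loc dA_lD (x := x).

Lemma nilA_gen b : b \in left_ideal nA <->
  b \in left_ideal (fun z => exists j, z = lA (E j)).
Proof.
split; elim/left_ideal_ind => [|b1 b2 e1 e2|b1 z Nz]; rewrite ?rpred0 ?rpredD//.
  have [u u_pos ->] := Nz; apply: left_idealM.
  pose P (u : g) := lA (gA u) \in left_ideal (fun z => exists j, z = lA (E j)).
  apply: (u_pos P) => [|_ [j ->]]; last by apply: mem_left_ideal; exists j.
  split=> [|y y' Py Py'].
    split=> [|c y y' Py Py']; rewrite /P; first by rewrite !linear0 rpred0.
    by rewrite !linearP /=; apply: rpredD => //; apply: left_idealZ.
  rewrite /P gA_bracket rmorphB !rmorphM; apply: rpredB; exact: left_idealM.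
have [j ->] := Nz; apply/left_idealM/mem_left_ideal; exists (gen_e g j) => //.
by move=> P _; apply; exists j.
Qed.

(** This makes the right action of [D] on the quotient well defined. *)
Lemma nilA_right b c : b \in left_ideal nA -> b * dA c \in left_ideal nA.
Proof.
move=> /nilA_gen bJ; apply/nilA_gen; move: bJ.
elim/left_ideal_ind => [|b1 b2 e1 e2|b1 _ [j ->]]; first by rewrite mul0r rpred0.
  by rewrite mulrDl rpredD.
have [c' cE] := moveR (integral_weight_e U_env gAE j) c.
by rewrite -mulrA cE mulrA; apply/left_idealM/mem_left_ideal; exists j.
Qed.

Let ract_dA b c : ract (lpi nA b) (dA c) = lpi nA (b * dA c).
Proof. by apply: ract_lpi => y; apply: nilA_right. Qed.

Let rhoP c b (x y : lquot nA) :
  ract (b *: x + y : lquot nA) (dA c) = b *: ract x (dA c) + ract y (dA c).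
Proof.
rewrite -[x]lreprK -[y]lreprK -lpi_linear !ract_dA -lpi_linear.
by rewrite mulrDl mulrA.
Qed.

Section OneReflection.
Variable i : 'I_r.
Local Notation ideal_s := (left_ideal (nAs i)).
Local Notation reflected := (reflected_raising iU i).

Lemma T'_gA u : T' i (lA (gA u)) = lA (jA (T i (iU u))).
Proof. by rewrite T'_lA gAE TA_jA. Qed.

(** [T_i(e_j)] lies in the ideal of the reflected generators because of its
weight; the converse is the weight argument for the inverse of [T_i]. *)
Lemma nilA_refl_gen b : b \in ideal_s <->
  b \in left_ideal (fun z => exists2 y, reflected y & z = lA (jA y)).
Proof.
have map1 u : u \in left_ideal reflected ->
    lA (jA u) \in left_ideal (fun z => exists2 y, reflected y & z = lA (jA y)).
  apply: (left_ideal_map (f := lA \o jA : {lrmorphism U -> A'})) => z zr /=.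
  by apply: mem_left_ideal; exists z.
split; elim/left_ideal_ind => [|b1 b2 e1 e2|b1 z Nz]; rewrite ?rpred0 ?rpredD//;
  apply: left_idealM.
  have [u u_pos ->] := Nz; rewrite T'_gA; apply: map1.
  pose P (u : g) := T i (iU u) \in left_ideal reflected.
  apply: (u_pos P) => [|_ [j ->]].
    split=> [|y y' Py Py'].
      split=> [|c y y' Py Py']; rewrite /P; first by rewrite !linear0 rpred0.
      by rewrite !linearP /=; apply: rpredD => //; apply: left_idealZ.
    have [iH _] := U_env; rewrite /P iH rmorphB !rmorphM; apply: rpredB; exact: left_idealM.
  exact: (automorphism_raising a_cartan U_env (T_cartan i)).
have [y yr ->] := Nz.
have := reflected_raising_automorphism a_cartan U_env (T_cartan i) (T_bij i) yr.
apply: (left_ideal_map (f := lA \o jA : {lrmorphism U -> A'})) => _ [j ->] /=.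
rewrite -T'_gA; apply: mem_left_ideal; exists (gen_e g j) => //.
by move=> P _; apply; exists j.
Qed.

Lemma T'_nilA b : b \in left_ideal nA -> T' i b \in ideal_s.
Proof.
apply: left_ideal_map => _ [u u_pos ->]; apply: mem_left_ideal.
by exists u.
Qed.

Lemma integral_weight_reflected y : reflected y -> integral_weight gA (jA y).
Proof.
case=> [->|[j [k [_ ->]]]]; first by rewrite -gAE; apply: (integral_weight_f U_env gAE).
elim: k => [|k IH] /=; first by rewrite -gAE; apply: (integral_weight_e U_env gAE).
rewrite rmorph_ad -gAE; apply: integral_weight_ad => //.
exact: (integral_weight_e U_env gAE).
Qed.

Section Map.
Variable q : A' -> lquot nA.
Hypothesis q_zhel : is_zhel kap gA lA dA (fun i => tau i) i q.
Let rho c (x : lquot nA) : lquot nA := ract x (dA c).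

Lemma zhel_setting : zhelobenko_setting lA dA (E i) (F i) (H (coroot g i))
  (kap (coroot g i)) (lpi nA 1) rho (tau i) q.
Proof.
have [a2 _ _] := a_cartan; have [qD qA qr] := q_zhel.
split=> //.
- by rewrite (ad_EF gA_bracket) eqxx.
- by rewrite (ad_HE gA_bracket) alpha_coroot a2 scaler_int.
- by rewrite (ad_HF gA_bracket) alpha_coroot a2 scaleNr scaler_int.
- exact: (kap_coroot_unit a_cartan a_sym D_loc).
- exact: (ad_e_nilpotent U_env A_adm gAE).
- apply/eqP; rewrite -lpiE lpi_eq0; apply: mem_left_ideal; exists (gen_e g i) => //.
  by move=> P _; apply; exists i.
- by move=> c; rewrite /rho ract_dA mul1r lpiE.
move=> x N xN; rewrite (qA x N xN) lpiE scaler_suml; apply: eq_bigr => n _.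
by rewrite /zhel_term /signed_ad linearZ /= -scalerAl mulrA.
Qed.

Local Notation Q := (zhigher lA dA (F i) (kap (coroot g i)) q).

Lemma q_reflected y : y \in ideal_s -> q y = 0.
Proof.
move=> /nilA_refl_gen; elim/left_ideal_ind => [|b1 b2 e1 e2|b _ [z zr ->]].
- by apply: (addrI (q 0)); rewrite -(zs_qD zhel_setting) !addr0.
- by rewrite (zs_qD zhel_setting) e1 e2 addr0.
have zw := integral_weight_reflected zr.
case: zr zw => [->|[j [k [ij ->]]]] zw.
  rewrite -gAE; apply: (q_lowering zhel_setting) => c; apply: moveL.
  exact: (integral_weight_f U_env gAE).
pose Z y := exists k (c : K), y = c *: iter k (ad (E i)) (E j).
have jAk m : jA (iter m (ad (iU (gen_e g i))) (iU (gen_e g j))) = iter m (ad (E i)) (E j).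
  by elim: m => [|m IH] /=; [rewrite gAE|rewrite rmorph_ad IH -gAE].
apply: (q_annihilated zhel_setting (Z := Z)).
- by move=> _ [m [c ->]]; exists m.+1, c; rewrite linearZ.
- move=> _ [[|m] [c ->]]; rewrite linearZ.
    by exists 0%N, 0; rewrite /= (ad_F_string0 gA_bracket ij) scaler0 scale0r.
  have [c' /= ->] := ad_F_string gA_bracket m ij.
  by exists m, (c * c'); rewrite scalerA.
- move=> _ [m [c ->]]; rewrite linearZ /= -mulr_algl -scalerA.
  apply/eqP; rewrite -[X in _ *: X]lpiE [X in _ *: X](_ : _ = 0) ?scaler0//.
  apply/eqP; rewrite lpi_eq0; apply: mem_left_ideal.
  rewrite (ad_lie_iter gA_bracket); eexists; last by [].
  move=> P Pl Pg; elim: m => [|m IH]; first by apply: Pg; exists j.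
  by case: Pl => _; apply=> //; apply: Pg; exists i.
- by exists k, 1; rewrite jAk scale1r.
exact: moveL.
Qed.

Lemma zhigher_reflected k y : y \in ideal_s -> Q k y = 0.
Proof.
elim: k y => [|k IH] y yJ; first exact: q_reflected.
by rewrite zhigherS !IH ?subr0 ?scaler0// left_idealM.
Qed.

Definition normalizes_reflected y := forall z, reflected z -> lA (jA z) * y \in ideal_s.

Lemma zhigher_f_normalizes y : normalizes_reflected y ->
  forall k, Q k (lA (F i) * y) = 0.
Proof. by move=> yn k; apply: zhigher_reflected; rewrite gAE; apply: yn; left. Qed.

(** [e_i] annihilates the image of [q]. For [j <> i] the element [e_j] starts a
string along which [Q_k (z y) = 0]. *)
Lemma q_normalizes y : normalizes_reflected y -> normalizer_quot (q y).
Proof.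
move=> yn; apply/normalizer_quotP => b /mem_left_ideal /nilA_gen.
elim/left_ideal_ind => [|b1 b2 e1 e2|b1 _ [j ->]]; first by rewrite scale0r.
  by rewrite scalerDl e1 e2 addr0.
rewrite -scalerA [X in _ *: X](_ : _ = 0) ?scaler0//.
have [->|ij] := eqVneq j i; first exact: (raising_q zhel_setting).
pose Z y := exists k, y = iter k (ad (E i)) (E j).
apply: (annihilated_q zhel_setting (Z := Z)); last by exists 0%N.
  by move=> _ [m ->]; exists m.+1.
move=> k _ [m ->]; apply: zhigher_reflected.
have -> : iter m (ad (E i)) (E j) = jA (iter m (ad (iU (gen_e g i))) (iU (gen_e g j))).
  by elim: m => [|m IH] /=; [rewrite gAE|rewrite rmorph_ad -IH -gAE].
by apply: yn; right; exists j, m; rewrite eq_sym.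
Qed.

Lemma q_left_kap h y : q (dA (kap h) * y) = dA (tau i (kap h)) *: q y.
Proof.
rewrite dA_kap (q_weight_left zhel_setting y (ad_HE gA_bracket h i)).
by rewrite tau_kap rmorphD /= dA_kap rmorph_alg.
Qed.

Lemma q_scale k y : q (k *: y) = k%:A *: q y.
Proof.
have k0 : ad (k%:A : A) (E i) = 0 *: E i.
  by rewrite scale0r adC -mulr_algl mulr1 linearZ /= /ad mulr1 mul1r subrr scaler0 oppr0.
have := q_weight_left zhel_setting y k0; rewrite rmorph_alg mulr_algl => ->.
by rewrite scale0r addr0.
Qed.

(** From the Cartan subalgebra to its enveloping algebra by multiplicativity,
then to the localization by inverting the images of the denominators. *)
Lemma q_left_D c y : q (dA c * y) = dA (tau i c) *: q y.
Proof.
have qD := zs_qD zhel_setting.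
have q0 : q 0 = 0 by apply: (addrI (q 0)); rewrite -qD !addr0.
have qU u : forall y, q (dA (lD u) * y) = dA (tau i (lD u)) *: q y.
  apply: (enveloping_ind (S := fun u => forall y, q (dA (lD u) * y) =
            dA (tau i (lD u)) *: q y) Uh_env) u.
  - split=> [y'|k u v uE vE y']; first by rewrite !rmorph0 mul0r scale0r.
    rewrite !linearP /= mulrDl qD vE scalerDl; congr (_ + _).
    by rewrite -scalerAl q_scale uE scalerA mulr_algl.
  - by move=> y'; rewrite !rmorph1 mul1r scale1r.
  - by move=> u v uE vE y'; rewrite !rmorphM -mulrA uE vE scalerA.
  exact: q_left_kap.
have [lU fracD _] := D_loc; have [u [s [Gs ->]]] := fracD c.
have sU := lU s Gs; have tsU := rmorph_unit (tau i) sU.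
have inv y' : q (dA (lD s)^-1 * y') = dA (tau i (lD s))^-1 *: q y'.
  rewrite -[in RHS](mul1r y') -(rmorph1 dA) -(mulrV sU) rmorphM -mulrA qU scalerA.
  by rewrite -rmorphM mulVr// rmorph1 scale1r.
by rewrite !rmorphM -mulrA qU inv scalerA /= (rmorphV (tau i) sU).
Qed.

(** On the Cartan subalgebra [T_i] is the simple reflection, and [tau]
composed with it is the shifted action. *)
Lemma q_right_T' c y : q (y * T' i (dA c)) = rho (sdot i c) (q y).
Proof.
have qD := zs_qD zhel_setting.
have q0 : q 0 = 0 by apply: (addrI (q 0)); rewrite -qD !addr0.
have rhoE c1 (m : lquot nA) : rho c1 m = lpi nA (lrepr m * dA c1).
  by rewrite /rho -{1}[m]lreprK ract_dA.
have rhoM c1 c2 m : rho c1 (rho c2 m) = rho (c1 * c2) m.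
  by rewrite /rho -[m]lreprK !ract_dA mulrC rmorphM mulrA.
have rho1 m : rho 1 m = m by rewrite rhoE rmorph1 mulr1 lreprK.
have qU u : forall y, q (y * T' i (dA (lD u))) = rho (sdot i (lD u)) (q y).
  apply: (enveloping_ind (S := fun u => forall y, q (y * T' i (dA (lD u))) =
            rho (sdot i (lD u)) (q y)) Uh_env) u.
  - split=> [y'|k u v uE vE y'].
      by rewrite !rmorph0 mulr0 rhoE rmorph0 mulr0 /lpi raddf0.
    rewrite !linearP /= mulrDr qD vE -scalerAr q_scale uE !rhoE linearP /= mulrDr.
    by rewrite -scalerAr -[k *: (_ * _)]mulr_algl lpi_linear.
  - by move=> y'; rewrite !rmorph1 mulr1 rho1.
  - by move=> u v uE vE y'; rewrite !rmorphM mulrA vE uE rhoM mulrC.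
  move=> h y'; have -> : T' i (dA (lD (iUh h))) = dA (kap (cartan_refl i h)).
    by rewrite -[lD _]/(kap h) !dA_kap T'_gA T_cartan -gAE.
  rewrite (zs_qr zhel_setting) tau_kap alpha_cartan_refl_diag// scaleNr.
  by rewrite -sdot_kap.
have [lU fracD _] := D_loc; have [u [s [Gs ->]]] := fracD c.
have sU := lU s Gs; have tsU := rmorph_unit (sdot i) sU.
have inv y' : q (y' * T' i (dA (lD s)^-1)) = rho (sdot i (lD s))^-1 (q y').
  rewrite -[in RHS](mulr1 y') -(rmorph1 (T' i)) -(rmorph1 dA) -(mulVr sU) !rmorphM mulrA.
  by rewrite qU rhoM mulVr// rho1.
by rewrite !rmorphM mulrA inv qU rhoM mulrC /= (rmorphV (sdot i) sU).
Qed.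

Lemma q_normalizes_mul x y : normalizes_reflected y -> q (x * y) = lrepr (q x) *: q y.
Proof.
move=> yn; have qyN := q_normalizes yn.
(* The ideal [A'n] annihilates [q y], so any representative of [q x] will do. *)
have repr_eq X m : lpi nA X = m -> X *: q y = lrepr m *: q y.
  move=> Xm; apply/eqP; rewrite -subr_eq0 -scalerBl; apply/eqP.
  by apply: normalizer_quot_ideal => //; apply/lpiP; rewrite lreprK.
elim/ind: x => [x1 x2 e1 e2|x c].
  rewrite mulrDl [LHS](zs_qD zhel_setting) e1 e2 -scalerDl; apply: repr_eq.
  by rewrite -[lrepr (q x1)]mul1r lpi_linear scale1r !lreprK (zs_qD zhel_setting).
have [X [qX qXy]] := q_factor zhel_setting x.
rewrite -mulrA qXy.
  rewrite q_left_D scalerA; apply: repr_eq.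
  by rewrite (zs_qr zhel_setting) qX -lpiE /rho ract_dA.
apply: zhigher_f_normalizes => z zr.
have [c' cE] := moveR (integral_weight_reflected zr) c.
by rewrite mulrA cE -mulrA left_idealM//; apply: yn.
Qed.

(** The reflected generators lie in [A' T_i(n)], and [T_i] carries [n y] into
[T_i(A'n)]. *)
Lemma T'_normalizes y : (forall z, nA z -> z * y \in left_ideal nA) ->
  normalizes_reflected (T' i y).
Proof.
move=> yn z zr.
have : lA (jA z) \in ideal_s.
  by apply/nilA_refl_gen/mem_left_ideal; exists z.
elim/left_ideal_ind => [|b1 b2 e1 e2|b _ [u u_pos ->]]; first by rewrite mul0r rpred0.
  by rewrite mulrDl rpredD.
rewrite -mulrA -rmorphM; apply/left_idealM/T'_nilA/yn.
by exists u.
Qed.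

End Map.

Local Notation qc := (qcheck kap gA lA dA (fun i => tau i) (fun i => T' i) i).

Lemma qcheck_lpi q X : is_zhel kap gA lA dA (fun i => tau i) i q ->
  zhel kap gA lA dA (fun i => tau i) i = q -> qc (lpi nA X) = q (T' i X).
Proof.
move=> qz qE; rewrite /qcheck /zhel_ind /T_ind qE.
have qB y z : y - z \in ideal_s -> q y = q z.
  move=> /(q_reflected qz) yz; have := zs_qD (zhel_setting qz) (y - z) z.
  by rewrite subrK yz add0r.
apply: qB; rewrite -[_ - _](subrKA (T' i (lrepr (lpi nA X)))) rpredD//.
  by apply/lpiP; rewrite lreprK.
by rewrite -rmorphB; apply: T'_nilA; apply/lpiP; rewrite lreprK.
Qed.

(** By convention [zhel] is zero when no map has the defining properties. *)
Lemma qcheck_zero : (forall q, ~ is_zhel kap gA lA dA (fun i => tau i) i q) ->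
  forall x, qc x = 0.
Proof.
by move=> noq x; rewrite /qcheck /zhel_ind /zhel xgetPN.
Qed.

(** If some map has the defining properties of the Zhelobenko operator, [zhel]
is one and the preceding lemmas apply to it; otherwise all three identities
compare zeros. *)
Lemma qcheck_zhelobenko :
  [/\ forall (x : lquot nA) (h : cartan g),
        qc (lquot_comm (dA (kap h)) x) = lquot_comm (dA (kap (cartan_refl i h))) (qc x),
      forall (x : lquot nA) (c : D), qc (ract x (dA c)) = ract (qc x) (dA (sdot i c))
    & forall x y : lquot nA, normalizer_quot y ->
        normalizer_quot (qc y) /\ qc (lquot_mul x y) = lquot_mul (qc x) (qc y)].
Proof.
have [[q0 q0z]|noq] := pselect (exists q, is_zhel kap gA lA dA (fun i => tau i) i q);
  last first.
  have qc0 := qcheck_zero (fun q qz => noq (ex_intro _ q qz)).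
  have act0 b : lact b (0 : lquot nA) = 0 by apply: scaler0.
  have ract0 c : ract (0 : lquot nA) (dA c) = 0.
    by rewrite -(raddf0 (\pi_(lquot nA))%qT) -/(lpi nA 0) ract_dA mul0r.
  split=> [x h|x c|x y _].
  - by rewrite !qc0 /lquot_comm act0 ract0 subrr.
  - by rewrite !qc0 ract0.
  split; first by rewrite qc0; apply/normalizer_quotP => z _; rewrite scaler0.
  by rewrite !qc0 lquot_mulE scaler0.
have qz : is_zhel kap gA lA dA (fun i => tau i) i (zhel kap gA lA dA (fun i => tau i) i).
  by apply: (@xgetPex _ (fun=> 0) [set q | is_zhel kap gA lA dA (fun i => tau i) i q]); exists q0.
set q := zhel _ _ _ _ _ _ in qz.
have qcE X : qc (lpi nA X) = q (T' i X) by apply: qcheck_lpi.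
have qB y z : q (y - z) = q y - q z.
  by apply: (addIr (q z)); rewrite -(zs_qD (zhel_setting qz)) !subrK.
split=> [x h|x c|x y yN].
- rewrite -[x]lreprK; move: (lrepr x) => X.
  have -> : lquot_comm (dA (kap h)) (lpi nA X) = lpi nA (dA (kap h) * X - X * dA (kap h)).
    by rewrite /lquot_comm lact_lpi ract_dA /lpi raddfB.
  rewrite !qcE rmorphB !rmorphM qB /=.
  have -> : T' i (dA (kap h)) = dA (kap (cartan_refl i h)).
    by rewrite !dA_kap T'_gA T_cartan -gAE.
  move: (cartan_refl i h) (T' i X) => h' Y.
  rewrite (q_left_kap qz) (zs_qr (zhel_setting qz)) tau_kap.
  move: (q Y) => m.
  have -> : ract m (dA (kap h' + (alpha i h')%:A)) =
      ract m (dA (kap h')) + (alpha i h')%:A *: m :> lquot nA.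
    rewrite -[m]lreprK !ract_dA rmorphD /= rmorph_alg mulrDr addrC [RHS]addrC -lpi_linear.
    by rewrite mulr_algl mulr_algr.
  by rewrite rmorphD /= rmorph_alg scalerDl opprD addrACA subrr addr0.
- by rewrite -[x]lreprK ract_dA !qcE rmorphM (q_right_T' qz).
have [y0 y0N yE] := yN.
have Tn := T'_normalizes y0N; rewrite yE qcE.
split; first exact: q_normalizes.
rewrite lquot_mulE -[in RHS](lreprK x) qcE -yE.
have -> : lrepr x *: y = lpi nA (lrepr x * y0) by rewrite yE [LHS]lact_lpi.
by rewrite qcE rmorphM (q_normalizes_mul qz _ Tn) lquot_mulE.
Qed.

End OneReflection.
End Assembly.

Theorem proposition6p2 (R : realType) (r : nat) (a : 'M[int]_r)
  (d : 'I_r -> nat) (g : kacMoody R[i] a)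
  (U : algType R[i]) (iU : {linear g -> U})
  (Uh : comAlgType R[i]) (iUh : {linear cartan g -> Uh})
  (jU : {lrmorphism Uh -> U})
  (D : comUnitAlgType R[i]) (lD : {lrmorphism Uh -> D})
  (tau sdot : 'I_r -> {lrmorphism D -> D})
  (A : algType R[i]) (jA : {lrmorphism U -> A})
  (A' : algType R[i]) (lA : {lrmorphism A -> A'}) (dA : {lrmorphism D -> A'})
  (T : 'I_r -> {lrmorphism U -> U}) (TA : 'I_r -> {lrmorphism A -> A})
  (T' : 'I_r -> {lrmorphism A' -> A'}) :
  let kap := lD \o iUh in
  let gA := jA \o iU in
  let nA := nilA gA lA in
  let q := qcheck kap gA lA dA tau T' in
  generalized_cartan a -> symmetrizes a d -> finite_growth g ->
  is_enveloping (@bracket _ g) iU ->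
  is_enveloping (fun _ _ => 0) iUh ->
  (forall h, jU (iUh h) = iU (cartan_in g h)) ->
  is_localization (localization_set d iUh) lD ->
  (forall i h, tau i (kap h) = kap h + (sroot g i h : R[i])%:A) ->
  (forall i h, sdot i (kap h) =
     kap (cartan_refl i h) - (sroot g i h : R[i])%:A) ->
  admissible iU jA ->
  (forall u, dA (lD u) = lA (jA (jU u))) ->
  is_balanced_tensor (fun (c : D) (u : Uh) => c * lD u)
    (fun (u : Uh) (x : A) => jA (jU u) * x) (fun c x => dA c * lA x) ->
  (forall i, bijective (T i)) ->
  (forall i h, T i (iU (cartan_in g h)) = iU (cartan_in g (cartan_refl i h))) ->
  braid_relations a (fun i => T i) ->
  (forall i, bijective (TA i)) ->
  (forall i u, TA i (jA u) = jA (T i u)) ->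
  braid_relations a (fun i => TA i) ->
  (forall i, bijective (T' i)) ->
  (forall i x, T' i (lA x) = lA (TA i x)) ->
  forall i : 'I_r,
    [/\ forall (x : lquot nA) (h : cartan g),
          q i (lquot_comm (dA (kap h)) x) =
          lquot_comm (dA (kap (cartan_refl i h))) (q i x),
        forall (x : lquot nA) (c : D),
          q i (ract x (dA c)) = ract (q i x) (dA (sdot i c))
      & forall x y : lquot nA, normalizer_quot y ->
          normalizer_quot (q i y) /\
          q i (lquot_mul x y) = lquot_mul (q i x) (q i y)].
Proof.
move=> kap gA nA q a_cartan a_sym _ U_env Uh_env jU_cartan D_loc tau_kap sdot_kap A_adm
  dA_lD A'_tensor T_bij T_cartan _ _ TA_jA _ _ T'_lA i.
exact: (qcheck_zhelobenko (gA := jA \o iU) a_cartan a_sym (fun=> erefl) U_env Uh_env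
  jU_cartan D_loc A_adm dA_lD A'_tensor tau_kap sdot_kap T_cartan T_bij TA_jA T'_lA i).
Qed.
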